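(* Let $\pi\colon A\to M$ be an affine bundle modeled on a vector bundle $\boldsymbol{V}\to M$, endowed with a (generally nonlinear) connection, and let $D$ be its linearization, a covariant derivative on $\pi^*\tilde A\to A$. The section $e^0\in\operatorname{Sec}(\pi^*A^\dagger)$ is parallel: $$D_Ue^0=0\qquad\forall\,U\in\mathfrak{X}(A).$$ The vector subbundle $\pi^*\boldsymbol{V}\subset\pi^*\tilde A$ and the affine subbundle $\pi^*A\subset\pi^*\tilde A$ are invariant under parallel transport: $$D_U\operatorname{Sec}(\pi^*\boldsymbol{V})\subset\operatorname{Sec}(\pi^*\boldsymbol{V})\quad\text{and}\quad D_U\operatorname{Sec}(\pi^*A)\subset\operatorname{Sec}(\pi^*\boldsymbol{V}),\qquad\forall\,U\in\mathfrak{X}(A).$$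
   Context: All objects are $C^\infty$. Linearization on vector bundles. Let $p\colon E\to M$ be a vector bundle and $E_0\subset E$ an open subset with a connection on it, i.e. a vector bundle morphism $\xi^H\colon p^*TM|_{E_0}\to TE_0$ over $\mathrm{id}_{E_0}$ with $Tp(\xi^H(a,v))=v$. Let $\xi^V(a,b)=\frac{d}{ds}(a+sb)|_{s=0}$ be the vertical lift, $\sigma^V(a)=\xi^V(a,\sigma(a))$ for a section $\sigma$ of $p^*E$ (viewed as a map to $E$ over $p$), $\kappa$ the left inverse of $\xi^V$ with $\kappa\circ\xi^H=0$, $P_V=\xi^V\circ\kappa$, $P_H=\mathrm{id}-P_V$. The linearization is the covariant derivative on $p^*E\to E_0$ given by $D_U\sigma=\kappa([P_H(U),\sigma^V])+\kappa(T\sigma(P_V(U)))$, the last term at $a$ being the derivative of $\sigma$ restricted to the fibre through $a$ in the vertical direction $P_V(U)_a$. Affine bundles. $\pi\colon A\to M$ is an affine bundle of finite rank modeled on $\boldsymbol{V}\to M$. $A^\dagger\to M$ is the vector bundle whose fibre $A_m^\dagger$ is the space of affine functions on $A_m$, and $\tilde\pi\colon\tilde A\to M$ is its dual vector bundle, $\tilde A=(A^\dagger)^*$; evaluation embeds $A\subset\tilde A$ fibrewise as an affine hyperplane and $\boldsymbol{V}\subset\tilde A$ as the parallel vector subbundle. The constant function $1$ on the fibres is a section of $A^\dagger=\tilde A^*$, denoted $e^0$ (the same symbol denotes its pullback to $\pi^*A^\dagger\to A$); thus $A=\{z:\langle e^0,z\rangle=1\}$ and $\boldsymbol{V}=\{z:\langle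 e^0,z\rangle=0\}$. A connection on $A$ is a vector bundle morphism $\xi^H\colon\pi^*TM\to TA$ over $\mathrm{id}_A$ with $T\pi(\xi^H(a,v))=v$. The homogeneous extension of the connection is the connection on $\tilde A\setminus\boldsymbol{V}$ given by $\xi^{\tilde H}(\lambda a,v)=T\mu_\lambda(\xi^H(a,v))$ for $\lambda\in\mathbb{R}\setminus\{0\}$, $a\in A$, where $\mu_\lambda(z)=\lambda z$. Let $\tilde D$ be its linearization, a covariant derivative on $\tilde\pi^*\tilde A\to\tilde A\setminus\boldsymbol{V}$. The linearization $D$ of the connection on $A$ is the restriction (pullback by the inclusion $A\subset\tilde A\setminus\boldsymbol{V}$) of $\tilde D$ to $A$: a covariant derivative on $\pi^*\tilde A\to A$. The same symbol $D$ denotes the dual connection on $\pi^*A^\dagger\to A$: $\langle D_U\beta,\sigma\rangle=U\langle\beta,\sigma\rangle-\langle\beta,D_U\sigma\rangle$. Sections of $\pi^*\tilde A$, $\pi^*A$, $\pi^*\boldsymbol{V}$ are viewed as maps from $A$ to $\tilde A$, $A$, $\boldsymbol{V}$ over $\mathrm{id}_M$. *)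

(* Defs.v *)
(** Smooth manifolds are not available in the library; they are set up here as
    Sikorski differential spaces over an arbitrary [R : realType]: a smooth
    structure on a type is given by its algebra of smooth real functions, and
    that algebra is described by a generating family.  Subspaces, products,
    tangent bundles and total spaces of bundles then all carry explicit smooth
    structures, and a manifold is a (Hausdorff, second countable) differential
    space that is locally diffeomorphic to open subsets of R^n.  *)
From HB Require Import structures.
From mathcomp Require Import all_boot all_order all_algebra.
From mathcomp Require Import all_classical all_reals all_analysis.
Set Implicit Arguments.
Unset Strict Implicit.
Unset Printing Implicit Defensive.
Import Order.TTheory GRing.Theory Num.Theory.
Import numFieldNormedType.Exports.
Local Open Scope classical_set_scope.
Local Open Scope ring_scope.

Section DifferentialSpaces.
Variable R : realType.

Definition partial n (i : 'I_n) (phi : 'rV[R]_n -> R) : 'rV[R]_n -> R :=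
  fun x => 'D_(delta_mx 0 i) phi x.

(** C^oo on R^n: all iterated partial derivatives are Frechet differentiable. *)
Definition smoothRn n (phi : 'rV[R]_n -> R) : Prop :=
  forall (s : seq 'I_n) x, differentiable (foldr (@partial n) phi s) x.

Definition eval_row T n (g : 'I_n -> T -> R) (x : T) : 'rV[R]_n :=
  \row_i g i x.

(** The smooth functions are not [dgens] but [Cinf] below: the smallest
    differential structure containing [dgens]. *)
Record diffSpace : Type := DiffSpace {
  dcarrier :> Type;
  dgens : set (dcarrier -> R) }.

(** Neighbourhoods in the initial topology of the generators (which is also the
    initial topology of all smooth functions). *)
Definition dnbhs (X : diffSpace) (x : X) (N : set X) : Prop :=
  exists n (g : 'I_n -> X -> R) (e : R),
    [/\ forall i, dgens (g i), 0 < e &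
        forall y, (forall i, `|g i y - g i x| < e) -> N y].

Definition dopen (X : diffSpace) (N : set X) : Prop :=
  forall x, N x -> dnbhs x N.

Definition Cinf (X : diffSpace) : set (X -> R) := [set f |
  forall x, exists n (g : 'I_n -> X -> R) (phi : 'rV[R]_n -> R),
    [/\ forall i, dgens (g i), smoothRn phi &
        dnbhs x [set y | f y = phi (eval_row g y)]] ].

Definition smooth (X Y : diffSpace) (f : X -> Y) : Prop :=
  forall h : Y -> R, Cinf h -> Cinf (h \o f).

Definition diffeomorphism (X Y : diffSpace) (f : X -> Y) : Prop :=
  exists f' : Y -> X,
    [/\ smooth f, smooth f', cancel f f' & cancel f' f].

Definition Rn (n : nat) : diffSpace :=
  @DiffSpace 'rV[R]_n [set h | exists i : 'I_n, h = fun x : 'rV[R]_n => x 0 i].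

Definition dsub (X : diffSpace) (P : set X) : diffSpace :=
  @DiffSpace {x : X | P x}
    [set h | exists2 f : X -> R, Cinf f & h = fun x => f (sval x)].

Definition dprod (X Y : diffSpace) : diffSpace :=
  @DiffSpace (X * Y)%type
    [set h | (exists2 f : X -> R, Cinf f & h = fun w => f w.1) \/
             (exists2 f : Y -> R, Cinf f & h = fun w => f w.2)].

Definition is_manifold (n : nat) (X : diffSpace) : Prop :=
  [/\ forall x y : X, x <> y -> exists N N' : set X,
        [/\ dnbhs x N, dnbhs y N' & N `&` N' = set0],
      exists B : nat -> set X, (forall k, dopen (B k)) /\
        forall x N, dnbhs x N -> exists k, B k x /\ B k `<=` N &
      forall x : X, exists (N : set X) (O : set (Rn n))
          (f : dsub N -> dsub O),
        [/\ dopen N, N x, dopen O & diffeomorphism f] ].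

(** Tangent vectors at [x]: derivations at [x] of the smooth functions, i.e.
    functionals obeying the chain rule for [phi(f_0, ..., f_{n-1})].  Linearity
    and the Leibniz rule are the cases [phi = a s + t] and [phi = s t]; on a
    manifold the converse holds by Hadamard's lemma.  The functionals are
    normalized to vanish on non-smooth functions, so that equality of tangent
    vectors is equality as derivations of smooth functions. *)
Definition is_derivation (X : diffSpace) (x : X) (v : (X -> R) -> R) : Prop :=
  (forall n (phi : 'rV[R]_n -> R) (f : 'I_n -> X -> R),
     smoothRn phi -> (forall i, Cinf (f i)) ->
     v (fun y => phi (eval_row f y)) =
     \sum_(i < n) partial i phi (eval_row f x) * v (f i)) /\
  (forall f, ~ Cinf f -> v f = 0).

Definition derivations (X : diffSpace) (x : X) : {pred (X -> R) -> R} :=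
  fun v => `[< is_derivation x v >].

Record tangent (X : diffSpace) (x : X) : Type := Tangent {
  tval :> (X -> R) -> R;
  tvalP : tval \in derivations x }.

End DifferentialSpaces.

HB.instance Definition _ (R : realType) (X : diffSpace R) (x : X) :=
  [isSub for @tval R X x].
HB.instance Definition _ (R : realType) (X : diffSpace R) (x : X) :=
  [Choice of tangent x by <:].

Lemma derivations_submod (R : realType) (X : diffSpace R) (x : X) :
  subsemimod_closed (derivations x).
Proof.
split; first split.
- apply/asboolP; split => // n phi f _ _.
  by rewrite big1// => i _; rewrite mulr0.
- move=> u v /asboolP[u1 u2] /asboolP[v1 v2]; apply/asboolP; split.
    move=> n phi f sphi sf; rewrite -[LHS]/(u _ + v _) u1// v1// -big_split/=.
    by apply: eq_bigr => i _; rewrite -mulrDr.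
  by move=> f nf; rewrite -[LHS]/(u f + v f) u2// v2// addr0.
- move=> a u /asboolP[u1 u2]; apply/asboolP; split.
    move=> n phi f sphi sf; rewrite -[LHS]/(a * u _) u1// mulr_sumr.
    by apply: eq_bigr => i _; rewrite mulrCA.
  by move=> f nf; rewrite -[LHS]/(a * u f) u2// mulr0.
Qed.

HB.instance Definition _ (R : realType) (X : diffSpace R) (x : X) :=
  GRing.isSubSemiModClosed.Build R ((X -> R) -> R) (derivations x)
    (derivations_submod x).
HB.instance Definition _ (R : realType) (X : diffSpace R) (x : X) :=
  [SubChoice_isSubLmodule of tangent x by <:].

Section SmoothCalculus.
Variable R : realType.

(** [w] as a tangent vector; only used on functionals [w] that are derivations
    of the smooth functions at [x] (the value is 0 otherwise). *)
Definition to_tangent (X : diffSpace R) (x : X) (w : (X -> R) -> R) :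
    tangent x :=
  insubd 0 (fun f => if `[< Cinf f >] then w f else 0).

Definition tangent_map (X Y : diffSpace R) (f : X -> Y) (x : X)
    (v : tangent x) : tangent (f x) :=
  to_tangent (f x) (fun h => v (h \o f)).

Definition tangent_bundle (X : diffSpace R) : diffSpace R :=
  @DiffSpace R {x : X & tangent x}
    [set h | (exists2 f : X -> R, Cinf f & h = fun w => f (projT1 w)) \/
             (exists2 f : X -> R, Cinf f & h = fun w : {x : X & tangent x} => projT2 w f)].

Definition vfield (X : diffSpace R) : Type := forall x : X, tangent x.

Definition smooth_vfield (X : diffSpace R) (U : vfield X) : Prop :=
  @smooth R X (tangent_bundle X) (fun x => existT _ x (U x)).

Definition lie_bracket (X : diffSpace R) (U W : vfield X) : vfield X :=
  fun x => to_tangent x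
    (fun f => U x (fun y => W y f) - W x (fun y => U y f)).

(** The total space of [q^* TM -> X]. *)
Definition pullback_TM (X M : diffSpace R) (q : X -> M) : diffSpace R :=
  @DiffSpace R {a : X & tangent (q a)}
    [set h | (exists2 f : X -> R, Cinf f & h = fun w => f (projT1 w)) \/
             (exists2 f : tangent_bundle M -> R, Cinf f &
                h = fun w : {a : X & tangent (q a)} =>
                  f (existT _ (q (projT1 w)) (projT2 w)))].

(** A connection on [q : X -> M] is a horizontal lift [q^* TM -> TX]. *)
Definition hlift (X M : diffSpace R) (q : X -> M) : Type :=
  forall a : X, tangent (q a) -> tangent a.

Definition is_connection (X M : diffSpace R) (q : X -> M) (xi : hlift q) :
    Prop :=
  [/\ forall a, linear (xi a),
      forall a (v : tangent (q a)), tangent_map q (xi a v) = v &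
      @smooth R (pullback_TM q) (tangent_bundle X)
        (fun w => existT _ (projT1 w) (xi (projT1 w) (projT2 w)))].

End SmoothCalculus.

Section VectorBundles.
Variables (R : realType) (M : diffSpace R).

(** A bundle is given by its family of fibres and the smooth structure of its
    total space, so that fibrewise structure is the structure of each fibre. *)
Record vbundle : Type := VBundle {
  vfib :> M -> lmodType R;
  vgens : set ({m : M & vfib m} -> R) }.

Definition vtot (E : vbundle) : diffSpace R :=
  @DiffSpace R {m : M & E m} (@vgens E).

Definition vproj (E : vbundle) (z : vtot E) : M := projT1 z.

Definition over (T : M -> Type) (N : set M) : set {m : M & T m} :=
  [set z | N (projT1 z)].

Definition local_map (T : M -> Type) (N : set M) r
    (phi : forall m, T m -> 'rV[R]_r) (z : {z : {m : M & T m} | over N z}) :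
    {m : M | N m} * 'rV[R]_r :=
  (exist _ (projT1 (sval z)) (svalP z),
   phi (projT1 (sval z)) (projT2 (sval z))).

(** The values of [phi] outside [N] are irrelevant. *)
Definition vtrivialization (E : vbundle) (N : set M) r
    (phi : forall m, E m -> 'rV[R]_r) : Prop :=
  (forall m, N m -> linear (phi m)) /\
  @diffeomorphism R (dsub (over N : set (vtot E))) (dprod (dsub N) (Rn R r))
    (local_map phi).

Definition is_vector_bundle (E : vbundle) : Prop :=
  smooth (@vproj E) /\
  forall m, exists N r (phi : forall m, E m -> 'rV[R]_r),
    [/\ dopen N, N m & vtrivialization N phi].

(** Sections of the pullback bundle [q^* E -> X]. *)
Definition section (X : diffSpace R) (E : vbundle) (q : X -> M) : Type :=
  forall x : X, E (q x).

Definition smooth_section (X : diffSpace R) (E : vbundle) (q : X -> M)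
    (s : section E q) : Prop :=
  @smooth R X (vtot E) (fun x => existT _ (q x) (s x)).

(** Covariant derivatives on [q^* E -> X]; only their values on smooth
    arguments are relevant. *)
Definition cov_op (X : diffSpace R) (E : vbundle) (q : X -> M) : Type :=
  vfield X -> section E q -> section E q.

Definition is_covariant_derivative (X : diffSpace R) (E : vbundle)
    (q : X -> M) (D : cov_op E q) : Prop :=
  [/\ forall U s, smooth_vfield U -> smooth_section s ->
        smooth_section (D U s),
      forall U U' s (f : X -> R),
        smooth_vfield U -> smooth_vfield U' -> smooth_section s -> Cinf f ->
        D (fun x => f x *: U x + U' x) s =
          (fun x => f x *: D U s x + D U' s x),
      forall U s s', smooth_vfield U -> smooth_section s ->
        smooth_section s' ->
        D U (fun x => s x + s' x) = (fun x => D U s x + D U s' x) &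
      forall U s (f : X -> R), smooth_vfield U -> smooth_section s -> Cinf f ->
        D U (fun x => f x *: s x) =
          (fun x => U x f *: s x + f x *: D U s x)].

(** The pullback along [f : Y -> X] of a covariant derivative on [q^* E -> X]:
    the covariant derivative on [(q o f)^* E -> Y] with
    [D_u (s o f) = D0_{Tf u} s]. *)
Definition is_pullback_derivative (X Y : diffSpace R) (E : vbundle)
    (q : X -> M) (f : Y -> X) (D0 : cov_op E q)
    (D : cov_op E (fun y => q (f y))) : Prop :=
  is_covariant_derivative D /\
  forall (U : vfield Y) (U0 : vfield X) (s : section E q),
    smooth_vfield U -> smooth_vfield U0 -> smooth_section s ->
    (forall y, U0 (f y) = tangent_map f (U y)) ->
    forall y, D U (fun y => s (f y)) y = D0 U0 s (f y).

End VectorBundles.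

Section Linearization.
Variables (R : realType) (M : diffSpace R) (E : vbundle M).

(** Vertical lift on the whole of [E]. *)
Definition vlift (z : vtot E) (b : E (projT1 z)) : tangent z :=
  to_tangent z (fun f : vtot E -> R =>
    derive1 (fun t : R => f (existT _ (projT1 z) (projT2 z + t *: b))) 0).

Variable E0 : set (vtot E).

Definition bproj (a : dsub E0) : M := projT1 (sval a).

Definition extend0 (f : dsub E0 -> R) (z : vtot E) : R :=
  if pselect (E0 z) is left h then f (exist _ z h) else 0.

(** Vertical lift on the open subset [E0]; [a + t b] lies in [E0] for small
    [t], so the way [f] is extended outside [E0] is irrelevant. *)
Definition vlift_on (a : dsub E0) (b : E (bproj a)) : tangent a :=
  to_tangent a (fun f : dsub E0 -> R =>
    derive1 (fun t : R => extend0 f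
      (existT _ (bproj a) (projT2 (sval a) + t *: b))) 0).

Variable xi : hlift bproj.

Definition kappa (a : dsub E0) : tangent a -> E (bproj a) :=
  xget (fun=> 0) [set k : tangent a -> E (bproj a) |
    [/\ linear k, forall b, k (vlift_on b) = b & forall v, k (xi v) = 0]].

Definition PV (a : dsub E0) (u : tangent a) : tangent a :=
  vlift_on (kappa u).

Definition PH (a : dsub E0) (u : tangent a) : tangent a := u - PV u.

(** [kappa] of a vertical vector of [E].  [T sigma (P_V U)] is a vertical
    vector at [sigma(a)], which in general is not a point of [E0]; on vertical
    vectors [kappa] is just the inverse of the vertical lift. *)
Definition vlift_inv (z : vtot E) (u : tangent z) : E (projT1 z) :=
  xget 0 [set b | vlift b = u].

Definition section_map (s : section E bproj) (a : dsub E0) : vtot E :=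
  existT _ (bproj a) (s a).

Definition linearization : cov_op E bproj := fun U s a =>
  kappa (lie_bracket (fun a => PH (U a)) (fun a => vlift_on (s a)) a)
  + @vlift_inv (section_map s a) (tangent_map (section_map s) (PV (U a))).

End Linearization.

Section AffineBundles.
Variables (R : realType) (M : diffSpace R) (V : vbundle M).

Record abundle : Type := ABundle {
  afib :> M -> Type;
  agens : set ({m : M & afib m} -> R);
  atr : forall m, afib m -> V m -> afib m }.

Definition atot (A : abundle) : diffSpace R :=
  @DiffSpace R {m : M & A m} (@agens A).

Definition aproj (A : abundle) (a : atot A) : M := projT1 a.

(** [A] is an affine bundle of finite rank modeled on [V]: the fibres are
    affine spaces over those of [V], and locally [A] is affinely isomorphic to
    [N x R^r], the linear part being a local trivialization of [V]. *)
Definition is_affine_bundle (A : abundle) : Prop :=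
  [/\ forall m (a : A m), atr a 0 = a,
      forall m (a : A m) v w, atr (atr a v) w = atr a (v + w),
      forall m (a b : A m), exists! v, atr a v = b,
      smooth (@aproj A) &
      forall m, exists N r (Phi : forall m, A m -> 'rV[R]_r)
          (phi : forall m, V m -> 'rV[R]_r),
        [/\ dopen N, N m, vtrivialization N phi,
            (forall m, N m -> forall (a : A m) v,
               Phi m (atr a v) = Phi m a + phi m v) &
            @diffeomorphism R (dsub (over N : set (atot A)))
              (dprod (dsub N) (Rn R r)) (local_map Phi)]].

Definition affine_functions (A : abundle) (m : M) : {pred A m -> R^o} :=
  fun al => `[< exists l : {linear V m -> R^o},
                  forall a v, al (atr a v) = al a + l v >].

End AffineBundles.

(** [A^dagger_m], the affine functions on [A_m]. *)
Record adual (R : realType) (M : diffSpace R) (V : vbundle M) (A : abundle V)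
    (m : M) : Type := ADual {
  adual_val :> A m -> R^o;
  adual_valP : adual_val \in @affine_functions R M V A m }.

HB.instance Definition _ (R : realType) (M : diffSpace R) (V : vbundle M)
  (A : abundle V) (m : M) := [isSub for @adual_val R M V A m].
HB.instance Definition _ (R : realType) (M : diffSpace R) (V : vbundle M)
  (A : abundle V) (m : M) := [Choice of adual A m by <:].

Lemma affine_functions_submod (R : realType) (M : diffSpace R)
  (V : vbundle M) (A : abundle V) (m : M) :
  subsemimod_closed (@affine_functions R M V A m).
Proof.
split; first split.
- apply/asboolP; exists (\0 : {linear V m -> R^o}) => a v.
  by rewrite /= addr0.
- move=> f g /asboolP[l fl] /asboolP[k gk]; apply/asboolP.
  exists (l \+ k : {linear V m -> R^o}) => a v.
  by rewrite -[LHS]/(f _ + g _) fl gk addrACA.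
- move=> c f /asboolP[l fl]; apply/asboolP.
  exists (c \*: l : {linear V m -> R^o}) => a v.
  by rewrite -[LHS]/(c *: f _) fl scalerDr.
Qed.

HB.instance Definition _ (R : realType) (M : diffSpace R) (V : vbundle M)
  (A : abundle V) (m : M) :=
  GRing.isSubSemiModClosed.Build R (A m -> R^o)
    (@affine_functions R M V A m) (@affine_functions_submod R M V A m).
HB.instance Definition _ (R : realType) (M : diffSpace R) (V : vbundle M)
  (A : abundle V) (m : M) := [SubChoice_isSubLmodule of adual A m by <:].

(** [A~_m], the dual of [A^dagger_m]. *)
Definition linear_forms (R : realType) (W : lmodType R) : {pred W -> R^o} :=
  fun z => `[< linear z >].

Record abidual (R : realType) (M : diffSpace R) (V : vbundle M)
    (A : abundle V) (m : M) : Type := ABidual {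
  abidual_val :> adual A m -> R^o;
  abidual_valP : abidual_val \in @linear_forms R (adual A m) }.

HB.instance Definition _ (R : realType) (M : diffSpace R) (V : vbundle M)
  (A : abundle V) (m : M) := [isSub for @abidual_val R M V A m].
HB.instance Definition _ (R : realType) (M : diffSpace R) (V : vbundle M)
  (A : abundle V) (m : M) := [Choice of abidual A m by <:].

Lemma linear_forms_submod (R : realType) (W : lmodType R) :
  subsemimod_closed (@linear_forms R W).
Proof.
split; first split.
- by apply/asboolP => a x y; rewrite scaler0 addr0.
- move=> f g /asboolP fl /asboolP gl; apply/asboolP => a x y.
  by rewrite -[LHS]/(f _ + g _) fl gl addrACA -scalerDr.
- move=> c f /asboolP fl; apply/asboolP => a x y.
  by rewrite -[LHS]/(c *: f _) fl scalerDr !scalerA mulrC.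
Qed.

HB.instance Definition _ (R : realType) (W : lmodType R) :=
  GRing.isSubSemiModClosed.Build R (W -> R^o)
    (@linear_forms R W) (@linear_forms_submod R W).
HB.instance Definition _ (R : realType) (M : diffSpace R) (V : vbundle M)
  (A : abundle V) (m : M) := [SubChoice_isSubLmodule of abidual A m by <:].

Section AffineDuals.
Variables (R : realType) (M : diffSpace R) (V : vbundle M) (A : abundle V).

(** Sections of the pullback [q^* A^dagger -> X].  Such a section is smooth
    when its evaluation [(x, a) |-> <beta(x), a>] is smooth on [X x_M A]; for
    [q = id], the smooth sections of [A^dagger] are the smooth functions on
    [A] that are affine on the fibres. *)
Definition dsection (X : diffSpace R) (q : X -> M) : Type :=
  forall x : X, adual A (q x).

Definition pullback_A (X : diffSpace R) (q : X -> M) : diffSpace R :=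
  @DiffSpace R {x : X & A (q x)}
    [set h | (exists2 f : X -> R, Cinf f & h = fun w => f (projT1 w)) \/
             (exists2 f : atot A -> R, Cinf f &
                h = fun w : {x : X & A (q x)} =>
                  f (existT _ (q (projT1 w)) (projT2 w)))].

Definition smooth_dsection (X : diffSpace R) (q : X -> M)
    (beta : dsection q) : Prop :=
  @Cinf R (pullback_A q) (fun w => beta (projT1 w) (projT2 w)).

(** The vector bundle [A~]: its smooth structure is generated by the smooth
    functions on [M] and the pairings with smooth sections of [A^dagger]. *)
Definition Atilde : vbundle M :=
  @VBundle R M (fun m => abidual A m : lmodType R)
    [set h | (exists2 f : M -> R, Cinf f & h = fun z => f (projT1 z)) \/
             (exists2 beta : dsection (fun m : M => m), smooth_dsection beta &
                h = fun z : {m : M & abidual A m} =>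
                  abidual_val (projT2 z) (beta (projT1 z)))].

Definition pairing (m : M) (al : adual A m) (z : Atilde m) : R :=
  abidual_val z al.

Lemma aeval_subproof (m : M) (a : A m) :
  (fun al : adual A m => al a : R^o) \in @linear_forms R (adual A m).
Proof. by apply/asboolP. Qed.

Definition aeval (m : M) (a : A m) : Atilde m := ABidual (aeval_subproof a).

Lemma e0_subproof (m : M) :
  (fun=> 1 : R^o) \in @affine_functions R M V A m.
Proof.
by apply/asboolP; exists (\0 : {linear V m -> R^o}) => a v; rewrite /= addr0.
Qed.

Definition e0 (m : M) : adual A m := ADual (e0_subproof m).

(** [A_m] and [V_m] as subsets of [A~_m]. *)
Definition inA (m : M) : set (Atilde m) := [set z | exists a, z = aeval a].

Definition inV (m : M) : set (Atilde m) :=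
  [set z | exists (a : A m) (v : V m), z = aeval (atr a v) - aeval a].

Definition offV : set (vtot Atilde) := [set z | ~ inV (projT2 z)].

Lemma offV_subproof (l : R) (a : atot A) : l != 0 ->
  offV (existT _ (projT1 a) (l *: aeval (projT2 a))).
Proof.
move=> l0 [b [v]] /= /(congr1 (fun z : abidual A (projT1 a) =>
  abidual_val z (e0 (projT1 a)))) h.
move/eqP: l0; apply.
transitivity (l * (1 : R)); first by rewrite mulr1.
by transitivity (1 - 1 : R); [exact: h | rewrite subrr].
Qed.

(** [a |-> l a], i.e. the restriction of [mu_l] to [A]. *)
Definition dilation (l : R) (l0 : l != 0) (a : atot A) : dsub offV :=
  exist _ (existT _ (projT1 a) (l *: aeval (projT2 a)) : vtot Atilde)
    (@offV_subproof l a l0).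

Lemma inclusion_subproof (a : atot A) :
  offV (existT _ (projT1 a) (aeval (projT2 a))).
Proof.
have := @offV_subproof 1 a (oner_neq0 R); by rewrite scale1r.
Qed.

Definition inclusion (a : atot A) : dsub offV :=
  exist _ (existT _ (projT1 a) (aeval (projT2 a)) : vtot Atilde)
    (@inclusion_subproof a).

Definition is_homogeneous_extension (xi : hlift (@aproj R M V A))
    (xit : hlift (@bproj R M Atilde offV)) : Prop :=
  is_connection xit /\
  forall (l : R) (l0 : l != 0) (a : atot A) (v : tangent (aproj a)),
    xit (dilation l0 a) v = tangent_map (dilation l0) (xi a v).

(** [D] is the linearization of the connection [xi] on [A]. *)
Definition is_affine_linearization (xi : hlift (@aproj R M V A))
    (D : cov_op Atilde (@aproj R M V A)) : Prop :=
  exists xit : hlift (@bproj R M Atilde offV),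
    is_homogeneous_extension xi xit /\
    @is_pullback_derivative R M (dsub offV) (atot A) Atilde
      (@bproj R M Atilde offV) inclusion (linearization xit) D.

(** [Dd] is the connection on [pi^* A^dagger] dual to [D]. *)
Definition is_dual_derivative (D : cov_op Atilde (@aproj R M V A))
    (Dd : vfield (atot A) -> dsection (@aproj R M V A) ->
          dsection (@aproj R M V A)) : Prop :=
  forall U beta, smooth_vfield U -> smooth_dsection beta ->
    smooth_dsection (Dd U beta) /\
    forall s : section Atilde (@aproj R M V A), smooth_section s ->
    forall a, pairing (Dd U beta a) (s a) =
      U a (fun b => pairing (beta b) (s b)) - pairing (beta a) (D U s a).

Definition secV (s : section Atilde (@aproj R M V A)) : Prop :=
  smooth_section s /\ forall a, inV (s a).

Definition secA (s : section Atilde (@aproj R M V A)) : Prop :=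
  smooth_section s /\ forall a, inA (s a).

End AffineDuals.

(* Main.v *)
Require Import Defs.
From HB Require Import structures.
From mathcomp Require Import all_boot all_order all_algebra.
From mathcomp Require Import all_classical all_reals all_analysis.
From mathcomp Require Import ring lra.
(* [dnbhs] denotes neighbourhoods in a differential space from here on. *)
Import Defs.
Set Implicit Arguments.
Unset Strict Implicit.
Unset Printing Implicit Defensive.
Import Order.TTheory GRing.Theory Num.Theory.
Import numFieldNormedType.Exports.
Local Open Scope classical_set_scope.
Local Open Scope ring_scope.

(** Everything reduces to one scalar identity: if [s] is a smooth section of
    [pi^* A], then [<e0, D_U s> = 0].  Indeed [V] is the zero level of [e0] in
    [A~] and [A] its level [1] ([pairing0_inV], [pairing1_inA]), so the identity
    is the invariance of [A].  The invariance of [V] follows by applying it to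
    [t] and to [t + s], where [t] is the tautological section [a |-> a] and [s]
    takes values in [V].  Finally the dual connection gives
    [<D_U e0, s> = U <e0, s> - <e0, D_U s> = U 1 - 0], and every point [b] of a
    fibre of [A] is a value of a section of [A] ([secA_through]), so the affine
    function [D_U e0] vanishes.

    The identity is proved off [V], for [eps = <e0, .>].  Every [z] off [V] is
    [eps z] times a point of [A]; this gives a smooth retraction of the
    complement of [V] onto [A], along which [s] extends to a section with
    [<e0, s> = 1] and [U] to a dilation-invariant vector field with [U eps = 0].
    A homogeneous horizontal lift annihilates [eps], since [eps] is the constant
    [l] on [l A] ([horizontal_eps]), and the vertical lift of [b] maps [eps] to
    [<e0, b>]; as vertical vectors are vertical lifts ([vertical_vlift]),
    [<e0, kappa u> = 0] whenever [u eps = 0] ([kappa_eps]).  Hence the vertical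
    and the horizontal part of [U] annihilate [eps], the vertical lift of [s]
    maps it to the constant [1], and their bracket annihilates it.  The other
    term of the linearization is the vertical derivative of [s], on which [e0]
    takes the value of the derivative of [<e0, s> = 1] ([linearization_eps]).

    The analytic input is the flat function [exp (-1/x)].  It gives cutoff
    functions on every differential space ([cutoff_exists]), hence the locality
    of derivations ([der_local]) and the extension to global objects of local
    frames of [A~] and its dual ([cut_coord], [smooth_cut_pt]).  The tangent
    vectors at a point are then determined by their values on the generators. *)

(** * Calculus in R^n *)
Section Calculus.
Variable R : realType.

Lemma eval_rowE (V : Type) n (h : 'I_n -> V -> R) :
  eval_row h = fun y => \sum_(i < n) h i y *: delta_mx 0 i.
Proof.
apply/funext => y; apply/rowP => j.
rewrite mxE summxE (bigD1 j)//= big1 ?addr0; last first.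
  by move=> i /negPf ij; rewrite !mxE eqxx [j == i]eq_sym ij mulr0.
by rewrite !mxE !eqxx mulr1.
Qed.

Lemma differentiable_eval_row (V : normedModType R) n (h : 'I_n -> V -> R) x :
  (forall i, differentiable (h i) x) -> differentiable (eval_row h) x.
Proof.
move=> dh; rewrite eval_rowE.
have -> : (fun y => \sum_(i < n) h i y *: delta_mx 0 i) =
    (\sum_(i < n) (fun y => h i y *: (delta_mx 0 i : 'rV[R]_n))).
  by apply/funext => y; rewrite fct_sumE.
by apply: differentiable_sum => i; exact: differentiableZl.
Qed.

Lemma derive_eval_row (V : normedModType R) n (h : 'I_n -> V -> R) x v :
  (forall i, differentiable (h i) x) ->
  'D_v (eval_row h) x = \sum_(i < n) 'D_v (h i) x *: delta_mx 0 i.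
Proof.
move=> dh; rewrite eval_rowE.
have -> : (fun y => \sum_(i < n) h i y *: delta_mx 0 i) =
    (\sum_(i < n) (fun y => h i y *: (delta_mx 0 i : 'rV[R]_n))).
  by apply/funext => y; rewrite fct_sumE.
rewrite derive_sum; last first.
  by move=> i; apply: diff_derivable; exact: differentiableZl.
apply: eq_bigr => i _; rewrite deriveE; last exact: differentiableZl.
by rewrite diffZl// -deriveE.
Qed.

Lemma chain_rule (V : normedModType R) n (h : 'I_n -> V -> R)
    (phi : 'rV[R]_n -> R) x v :
  (forall i, differentiable (h i) x) -> differentiable phi (eval_row h x) ->
  differentiable (fun y => phi (eval_row h y)) x /\
  'D_v (fun y => phi (eval_row h y)) x =
    \sum_(i < n) partial i phi (eval_row h x) * 'D_v (h i) x.
Proof.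
move=> dh dphi; have drow := differentiable_eval_row dh.
split; first exact: (differentiable_comp drow dphi).
rewrite deriveE; last exact: (differentiable_comp drow dphi).
rewrite (diff_comp drow dphi) /= -(deriveE _ drow) derive_eval_row// linear_sum /=.
by apply: eq_bigr => i _; rewrite linearZ /= -(deriveE _ dphi) mulrC.
Qed.

Lemma smoothRn_diff n (phi : 'rV[R]_n -> R) x :
  smoothRn phi -> differentiable phi x.
Proof. by move/(_ [::] x). Qed.

Lemma smoothRn_partial n (phi : 'rV[R]_n -> R) i :
  smoothRn phi -> smoothRn (partial i phi).
Proof. by move=> sphi s x; have := sphi (rcons s i) x; rewrite foldr_rcons. Qed.

(** Smoothness is the largest class of differentiable functions that is closed
    under partial derivatives. *)
Lemma smoothRn_coind n (P : ('rV[R]_n -> R) -> Prop) :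
  (forall f, P f -> forall x, differentiable f x) ->
  (forall f i, P f -> P (partial i f)) ->
  forall f, P f -> smoothRn f.
Proof.
move=> Pd Pp f Pf s; elim/last_ind: s f Pf => [|s i IH] f Pf x; first exact: Pd.
by rewrite foldr_rcons; apply: IH; exact: Pp.
Qed.

(** [P(1/x) exp(-1/x)] continued by [0]: unlike [exp(-1/x)] alone, this family
    is closed under derivation. *)
Definition flat_poly (p : {poly R}) (x : R) : R :=
  if 0 < x then p.[x^-1] * expR (- x^-1) else 0.

Lemma expR_pow_bound k (t : R) : 0 < t ->
  t ^+ k * expR (- t) <= k.+1`!%:R / t.
Proof.
move=> t0; rewrite expRN ler_pdivlMr// mulrAC -exprSr.
rewrite ler_pdivrMr ?expR_gt0//.
have := @expR_ge1Dxn R t k (ltW t0).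
have f0 : (0 : R) < k.+1`!%:R by rewrite ltr0n fact_gt0.
move=> h; rewrite -ler_pdivrMl// mulrC (le_trans _ h)// lerDr//.
Qed.

(** Applied to [P * 'X], this bounds the difference quotients of [flat_poly P]
    at [0]. *)
Lemma flat_poly_bound p : exists2 C, 0 <= C &
  forall x, `|flat_poly p x| <= C * `|x|.
Proof.
exists (\sum_(i < size p) `|p`_i| * i.+1`!%:R).
  by apply: sumr_ge0 => i _; rewrite mulr_ge0.
move=> x; rewrite /flat_poly; case: ifPn => x0; last first.
  by rewrite normr0 mulr_ge0// sumr_ge0// => i _; rewrite mulr_ge0.
rewrite horner_coef mulr_suml mulr_suml.
rewrite (le_trans (ler_norm_sum _ _ _))// ler_sum// => i _.
rewrite -mulrA normrM -mulrA ler_wpM2l//.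
have t0 : 0 < x^-1 by rewrite invr_gt0.
rewrite ger0_norm; last by rewrite mulr_ge0 ?expR_ge0// exprn_ge0// ltW.
by have := @expR_pow_bound i _ t0; rewrite invrK (gtr0_norm x0).
Qed.

Lemma flat_polyX p x : x^-1 * flat_poly p x = flat_poly (p * 'X) x.
Proof.
rewrite /flat_poly; case: ifP => _; last by rewrite mulr0.
by rewrite hornerMX mulrA [x^-1 * _]mulrC.
Qed.

Lemma is_derive_flat_poly p (x : R) :
  is_derive x 1 (flat_poly p) (flat_poly ('X^2 * (p - p^`())) x).
Proof.
have [x0|x0|x0] := ltgtP x 0.
- have -> : flat_poly ('X^2 * (p - p^`())) x = 0.
    by rewrite /flat_poly ltNge ltW.
  apply: (@near_eq_is_derive _ _ _ (cst 0)).
  near=> y; rewrite /flat_poly ifF//; apply/negbTE; rewrite -leNgt ltW//.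
  near: y; exact: lt_nbhsl.
- have xn0 : x != 0 by rewrite gt_eqF.
  have near_pos : {near x, (fun y => p.[y^-1] * expR (- y^-1)) =1 flat_poly p}.
    near=> y; rewrite /flat_poly ifT//; near: y; exact: lt_nbhsr.
  apply: (near_eq_is_derive near_pos).
  rewrite /flat_poly x0.
  have dinv : is_derive x 1 (fun y : R => y^-1) (- x ^- 2).
    apply: is_derive_eq; first exact: (is_deriveV xn0).
    by rewrite scaleNr [_ *: _]mulr1.
  have dp := @is_derive1_comp R (horner p) (fun y => y^-1) x _ _
    (is_derive_poly p x^-1) dinv.
  have de := @is_derive1_comp R expR (fun y => - y^-1) x _ _
    (is_derive_expR (- x^-1)) (is_deriveN dinv).
  have dpe := is_deriveM dp de.
  refine (@is_derive_eq _ _ _ _ x 1 _ _ (dpe : is_derive x (1 : R)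
    (fun y : R => p.[y^-1] * expR (- y^-1)) _) _).
  rewrite !hornerE /= /GRing.scale /= exprVn.
  ring.
- rewrite x0 {2}/flat_poly ltxx.
  have [C C0 hC] := flat_poly_bound (p * 'X).
  have lim0 : h^-1 *: ((flat_poly p \o shift 0) (h *: 1) - flat_poly p 0)
      @[h --> 0^'] --> (0 : R).
    apply/cvgrPdist_le => e e0; near=> h.
    rewrite /= {2}/flat_poly ltxx subr0 sub0r normrN addr0 [h *: 1]mulr1.
    rewrite [_ *: _]flat_polyX (le_trans (hC _))//.
    rewrite (@le_trans _ _ ((C + 1) * `|h|))// ?ler_wpM2r ?lerDl//.
    rewrite mulrC -ler_pdivlMr ?ltr_wpDl//; near: h.
    apply: dnbhs0_le; rewrite divr_gt0// ltr_wpDl//.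
  apply: DeriveDef; first by apply/cvg_ex; exists 0.
  exact: cvg_lim.
Unshelve. all: by end_near.
Qed.

(** The partial derivative of an expression of one of these forms is again a sum
    of products of such expressions, so that all the closure properties of
    smooth functions follow from one coinduction ([smooth_exprP]). *)
Inductive smooth_expr n : ('rV[R]_n -> R) -> Prop :=
| SmoothBase phi : smoothRn phi -> smooth_expr phi
| SmoothCst c : smooth_expr (fun=> c)
| SmoothCoord i : smooth_expr (fun x => x 0 i)
| SmoothAdd f g : smooth_expr f -> smooth_expr g ->
    smooth_expr (fun x => f x + g x)
| SmoothMul f g : smooth_expr f -> smooth_expr g ->
    smooth_expr (fun x => f x * g x)
| SmoothComp k (phi : 'rV[R]_k -> R) (psi : 'I_k -> 'rV[R]_n -> R) :
    smoothRn phi -> (forall i, smoothRn (psi i)) ->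
    smooth_expr (fun x => phi (eval_row psi x))
| SmoothInv psi : smoothRn psi -> (forall x, psi x != 0) ->
    smooth_expr (fun x => (psi x)^-1)
| SmoothFlat p psi : smoothRn psi -> smooth_expr (fun x => flat_poly p (psi x)).

Lemma smooth_expr_sum n m (F : 'I_m -> 'rV[R]_n -> R) :
  (forall i, smooth_expr (F i)) -> smooth_expr (fun x => \sum_(i < m) F i x).
Proof.
elim: m F => [|m IH] F sF.
  under eq_fun do rewrite big_ord0.
  exact: SmoothCst.
under eq_fun do rewrite big_ord_recl.
by apply: SmoothAdd => //; exact: IH.
Qed.

Lemma differentiable_flat_poly p (x : R) : differentiable (flat_poly p) x.
Proof.
by apply/derivable1_diffP; apply: ex_derive; exact: is_derive_flat_poly.
Qed.

Lemma smooth_expr_diff n (f : 'rV[R]_n -> R) x :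
  smooth_expr f -> differentiable f x.
Proof.
elim=> {f}.
- by move=> phi sphi; exact: smoothRn_diff.
- by move=> c; exact: differentiable_cst.
- by move=> i; exact: differentiable_coord.
- by move=> f g _ df _ dg; exact: differentiableD.
- by move=> f g _ df _ dg; exact: differentiableM.
- move=> k phi psi sphi spsi.
  by have [] := @chain_rule _ _ psi phi x 0
    (fun i => smoothRn_diff x (spsi i)) (smoothRn_diff _ sphi).
- move=> psi spsi psi0; apply: differentiableV => //; exact: smoothRn_diff.
- move=> p psi spsi; apply: (differentiable_comp (smoothRn_diff x spsi)).
  exact: differentiable_flat_poly.
Qed.

Lemma partial_coord n (i j : 'I_n) x :
  partial i (fun u : 'rV[R]_n => u 0 j) x = (i == j)%:R.
Proof.
rewrite /partial deriveE; last exact: differentiable_coord.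
pose f (N : 'rV[R]_n) : R := N 0 j.
have lf : linear f by move=> a u v; rewrite /f !mxE.
pose g : {linear 'rV[R]_n -> R} := HB.pack f (GRing.isLinear.Build _ _ _ _ f lf).
have cg : continuous g by move=> u; exact: coord_continuous.
have -> : (fun u : 'rV[R]_n => u 0 j) = g by [].
by rewrite diff_lin//= /f mxE eqxx eq_sym.
Qed.

Lemma smooth_expr_partial n (f : 'rV[R]_n -> R) i :
  smooth_expr f -> smooth_expr (partial i f).
Proof.
rewrite /partial; elim=> {f}.
- by move=> phi sphi; apply/SmoothBase/smoothRn_partial.
- move=> c; rewrite [X in smooth_expr X](_ : _ = cst 0) ?SmoothCst//.
    exact: SmoothCst.
  by apply/funext => x; rewrite derive_cst.
- move=> j; rewrite [X in smooth_expr X](_ : _ = cst ((i == j)%:R)).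
    exact: SmoothCst.
  by apply/funext => x; exact: partial_coord.
- move=> f g sf IHf sg IHg.
  rewrite [X in smooth_expr X](_ : _ =
    (fun x => 'D_(delta_mx 0 i) f x + 'D_(delta_mx 0 i) g x)).
    exact: SmoothAdd.
  apply/funext => x; rewrite -deriveD//;
    by apply: diff_derivable; exact: smooth_expr_diff.
- move=> f g sf IHf sg IHg.
  rewrite [X in smooth_expr X](_ : _ =
    (fun x => f x * 'D_(delta_mx 0 i) g x + g x * 'D_(delta_mx 0 i) f x)).
    by apply: SmoothAdd; exact: SmoothMul.
  apply/funext => x; rewrite -[RHS]deriveM//;
    by apply: diff_derivable; exact: smooth_expr_diff.
- move=> k phi psi sphi spsi.
  rewrite [X in smooth_expr X](_ : _ = (fun x => \sum_(j < k)
     partial j phi (eval_row psi x) * partial i (psi j) x)).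
    apply: smooth_expr_sum => j; apply: SmoothMul.
      by apply: SmoothComp => //; exact: smoothRn_partial.
    by apply/SmoothBase/smoothRn_partial.
  apply/funext => x.
  by have [_ ->] := @chain_rule _ _ psi phi x (delta_mx 0 i)
    (fun i => smoothRn_diff x (spsi i)) (smoothRn_diff _ sphi).
- move=> psi spsi psi0.
  rewrite [X in smooth_expr X](_ : _ =
    (fun x => (-1 * (psi x)^-1) * ((psi x)^-1 * partial i psi x))).
    have sV := SmoothInv spsi psi0.
    apply: SmoothMul; apply: SmoothMul => //; first exact: SmoothCst.
    by apply/SmoothBase/smoothRn_partial.
  apply/funext => x; rewrite deriveV//; last first.
    by apply: diff_derivable; exact: smoothRn_diff.
  rewrite /partial /GRing.scale /= expr2 invfM mulN1r !mulNr; congr (- _).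
  by rewrite mulrA.
- move=> p psi spsi.
  rewrite [X in smooth_expr X](_ : _ =
    (fun x => flat_poly ('X^2 * (p - p^`())) (psi x) * partial i psi x)).
    apply: SmoothMul; first exact: SmoothFlat.
    by apply/SmoothBase/smoothRn_partial.
  apply/funext => x; have dpsi := smoothRn_diff x spsi.
  have dflat := @differentiable_flat_poly p (psi x).
  rewrite deriveE; last exact: (differentiable_comp dpsi dflat).
  rewrite (diff_comp dpsi dflat) /= -(deriveE _ dpsi).
  rewrite diff1E// derive1E (@derive_val _ _ _ _ _ _ _ (is_derive_flat_poly p (psi x))).
  by rewrite [_ *: _]mulrC.
Qed.

Lemma smooth_exprP n (f : 'rV[R]_n -> R) : smooth_expr f -> smoothRn f.
Proof.
apply: smoothRn_coind => {}f; first by move=> sf x; exact: smooth_expr_diff.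
by move=> i; exact: smooth_expr_partial.
Qed.

End Calculus.

(** * Differential spaces *)
Section Spaces.
Variable R : realType.
Implicit Types X Y Z : diffSpace R.

Lemma dnbhs_self X (x : X) N : dnbhs x N -> N x.
Proof. by move=> [n [g [e [_ e0]]]]; apply=> i; rewrite subrr normr0. Qed.

Lemma dnbhsT X (x : X) : dnbhs x setT.
Proof. by exists 0%N, (fun=> cst 0), 1; split => // -[]. Qed.

Lemma dnbhsS X (x : X) N N' : N `<=` N' -> dnbhs x N -> dnbhs x N'.
Proof.
by move=> NN' [n [g [e [gg e0 h]]]]; exists n, g, e; split => // y /h /NN'.
Qed.

(** Juxtaposition of finite families, used to see functions that depend on
    different generators as functions of a common family. *)
Definition cat_fam T n m (g : 'I_n -> T) (h : 'I_m -> T) (k : 'I_(n + m)) : T :=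
  match fintype.split k with inl i => g i | inr j => h j end.

Lemma cat_faml T n m (g : 'I_n -> T) (h : 'I_m -> T) i :
  cat_fam g h (lshift m i) = g i.
Proof. by rewrite /cat_fam (unsplitK (inl i)). Qed.

Lemma cat_famr T n m (g : 'I_n -> T) (h : 'I_m -> T) j :
  cat_fam g h (rshift n j) = h j.
Proof. by rewrite /cat_fam (unsplitK (inr j)). Qed.

Lemma cat_famP T n m (g : 'I_n -> T) (h : 'I_m -> T) (P : T -> Prop) :
  (forall i, P (g i)) -> (forall j, P (h j)) -> forall k, P (cat_fam g h k).
Proof. by move=> Pg Ph k; rewrite /cat_fam; case: fintype.split. Qed.

Lemma dnbhsI X (x : X) N N' : dnbhs x N -> dnbhs x N' -> dnbhs x (N `&` N').
Proof.
move=> [n [g [e [gg e0 h]]]] [n' [g' [e' [gg' e0' h']]]].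
exists (n + n')%N, (cat_fam g g'), (Num.min e e'); split.
- exact: cat_famP.
- by rewrite lt_min e0.
- move=> y hy; split.
    apply: h => i; have := hy (lshift n' i).
    by rewrite cat_faml lt_min => /andP[].
  apply: h' => i; have := hy (rshift n i).
  by rewrite cat_famr lt_min => /andP[].
Qed.

Lemma dnbhs_forall X (x : X) n (N : 'I_n -> set X) :
  (forall i, dnbhs x (N i)) -> dnbhs x [set y | forall i, N i y].
Proof.
elim: n N => [|n IH] N hN; first by apply: dnbhsS (dnbhsT x) => y _ [].
apply: dnbhsS (dnbhsI (hN ord0) (IH _ (fun i => hN (lift ord0 i)))).
by move=> y [y0 yi] i; case: (unliftP ord0 i) => [j ->|->].
Qed.

(** Around [y] the ball may have any radius [d] below the slack
    [e - max_i |g_i y - g_i x|]. *)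
Lemma dnbhs_interior X (x : X) N : dnbhs x N -> dnbhs x [set y | dnbhs y N].
Proof.
move=> [n [g [e [gg e0 h]]]]; exists n, g, e; split => // y hy.
have [d d0 hd] : exists2 d, 0 < d & forall i, `|g i y - g i x| + d <= e.
  have ge0 : 0 <= \big[Order.max/0]_i `|g i y - g i x|.
    by elim/big_ind : _ => // a b a0 b0; rewrite le_max a0.
  exists (e - \big[Order.max/0]_i `|g i y - g i x|).
    rewrite subr_gt0; elim/big_ind : _ => //.
    by move=> a b ae be; rewrite gt_max ae.
  by move=> i; rewrite addrCA gerDl subr_le0 (le_bigmax _ (fun i => `|g i y - g i x|)).
exists n, g, d; split => // z hz; apply: h => i.
rewrite (le_lt_trans (ler_distD (g i y) _ _))// addrC.
by rewrite (lt_le_trans _ (hd i))// ltrD2l.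
Qed.

Lemma Cinf_gen X (f : X -> R) : dgens f -> Cinf f.
Proof.
move=> gf x; exists 1%N, (fun=> f), (fun u => u 0 0); split => //.
  exact/smooth_exprP/SmoothCoord.
by apply: dnbhsS (dnbhsT x) => y _; rewrite /= mxE.
Qed.

Lemma eval_row_coord n m (T : Type) (s : 'I_n -> 'I_m) (g : 'I_m -> T -> R) y :
  eval_row (fun i (u : 'rV[R]_m) => u 0 (s i)) (eval_row g y) =
  eval_row (fun i => g (s i)) y.
Proof. by apply/rowP => i; rewrite !mxE. Qed.

Lemma smoothRn_reindex n m (s : 'I_n -> 'I_m) (phi : 'rV[R]_n -> R) :
  smoothRn phi ->
  smoothRn (fun u => phi (eval_row (fun i (u : 'rV[R]_m) => u 0 (s i)) u)).
Proof.
move=> sphi; apply/smooth_exprP/SmoothComp => // i.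
exact/smooth_exprP/SmoothCoord.
Qed.

Lemma Cinf_common_gens X m (f : 'I_m -> X -> R) x : (forall i, Cinf (f i)) ->
  exists n (g : 'I_n -> X -> R) (phi : 'I_m -> 'rV[R]_n -> R),
    [/\ forall i, dgens (g i), forall i, smoothRn (phi i) &
        dnbhs x [set y | forall i, f i y = phi i (eval_row g y)]].
Proof.
elim: m f => [|m IH] f sf.
  exists 0%N, (fun=> cst 0), (fun=> cst 0); split => [[]//|[]//|].
  by apply: dnbhsS (dnbhsT x) => y _ [].
have [n1 [g1 [phi1 [gg1 sphi1 h1]]]] := sf ord0 x.
have [n2 [g2 [phi2 [gg2 sphi2 h2]]]] := IH _ (fun i => sf (lift ord0 i)).
exists (n1 + n2)%N, (cat_fam g1 g2),
  (fun i => if unlift ord0 i is Some j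
     then fun u => phi2 j (eval_row (fun i (u : 'rV[R]__) => u 0 (rshift n1 i)) u)
     else fun u => phi1 (eval_row (fun i (u : 'rV[R]__) => u 0 (lshift n2 i)) u)).
split.
- exact: cat_famP.
- by move=> i; case: unliftP => [j _|_]; exact: smoothRn_reindex.
- apply: dnbhsS (dnbhsI h1 h2) => y [/= y1 y2] i.
  case: unliftP => [j ->|->]; rewrite eval_row_coord.
    by rewrite y2; congr (phi2 j _); apply/rowP => k; rewrite !mxE cat_famr.
  by rewrite y1; congr phi1; apply/rowP => k; rewrite !mxE cat_faml.
Qed.

Lemma Cinf_comp X m (f : 'I_m -> X -> R) (phi : 'rV[R]_m -> R) :
  smoothRn phi -> (forall i, Cinf (f i)) ->
  Cinf (fun y => phi (eval_row f y)).
Proof.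
move=> sphi sf x.
have [n [g [psi [gg spsi h]]]] := Cinf_common_gens x sf.
exists n, g, (fun u => phi (eval_row psi u)); split => //.
  exact/smooth_exprP/SmoothComp.
apply: dnbhsS h => y hy /=; congr phi.
by apply/rowP => i; rewrite !mxE hy.
Qed.

Lemma Cinf_local X (f : X -> R) :
  (forall x, exists2 g, Cinf g & dnbhs x [set y | f y = g y]) -> Cinf f.
Proof.
move=> h x; have [g sg fg] := h x.
have [n [k [phi [gk sphi e]]]] := sg x.
exists n, k, phi; split => //.
by apply: dnbhsS (dnbhsI fg e) => y /= [-> ->].
Qed.

Lemma Cinf_cst X c : Cinf (fun _ : X => c).
Proof.
apply: (@Cinf_comp X 0 (fun=> cst 0) (fun=> c)) => [|[]//].
exact/smooth_exprP/SmoothCst.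
Qed.

Lemma Cinf_op2 X (f g : X -> R) (phi : 'rV[R]_2 -> R) :
  smoothRn phi -> Cinf f -> Cinf g ->
  Cinf (fun y => phi (eval_row (fun i : 'I_2 => if i == 0 then f else g) y)).
Proof. by move=> sphi sf sg; apply: Cinf_comp => // i; case: ifP. Qed.

Lemma CinfD X (f g : X -> R) : Cinf f -> Cinf g -> Cinf (fun y => f y + g y).
Proof.
move=> sf sg.
have sphi : smoothRn (fun u : 'rV[R]_2 => u 0 0 + u 0 1).
  by apply/smooth_exprP/SmoothAdd; exact: SmoothCoord.
by have := Cinf_op2 sphi sf sg; under eq_fun do rewrite !mxE /=.
Qed.

Lemma CinfM X (f g : X -> R) : Cinf f -> Cinf g -> Cinf (fun y => f y * g y).
Proof.
move=> sf sg.
have sphi : smoothRn (fun u : 'rV[R]_2 => u 0 0 * u 0 1).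
  by apply/smooth_exprP/SmoothMul; exact: SmoothCoord.
by have := Cinf_op2 sphi sf sg; under eq_fun do rewrite !mxE /=.
Qed.

Lemma CinfB X (f g : X -> R) : Cinf f -> Cinf g -> Cinf (fun y => f y - g y).
Proof.
move=> sf sg; under eq_fun do rewrite -mulN1r.
by apply: CinfD => //; apply: CinfM => //; exact: Cinf_cst.
Qed.

Lemma Cinf_sum X n (f : 'I_n -> X -> R) :
  (forall i, Cinf (f i)) -> Cinf (fun y => \sum_(i < n) f i y).
Proof.
elim: n f => [|n IH] f sf.
  by under eq_fun do rewrite big_ord0; exact: Cinf_cst.
under eq_fun do rewrite big_ord_recl.
by apply: CinfD => //; exact: IH.
Qed.

Lemma Cinf_continuous X (f : X -> R) x e : Cinf f -> 0 < e ->
  dnbhs x [set y | `|f y - f x| < e].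
Proof.
move=> sf e0; have [n [g [phi [gg sphi h]]]] := sf x.
have /differentiable_continuous := smoothRn_diff (eval_row g x) sphi.
move=> /cvgrPdist_lt /(_ _ e0)/nbhs_ballP[d /= d0 hd].
have fx := dnbhs_self h.
have h' : dnbhs x [set y | forall i, `|g i y - g i x| < d] by exists n, g, d.
apply: dnbhsS (dnbhsI h h') => y [/= -> hy]; rewrite fx distrC; apply: hd.
by split=> // i j; rewrite !mxE /ball /= distrC; exact: hy.
Qed.

(** ** Smooth maps *)

Lemma smooth_dnbhs X Y (f : X -> Y) x N :
  smooth f -> dnbhs (f x) N -> dnbhs x (f @^-1` N).
Proof.
move=> sf [n [g [e [gg e0 h]]]].
have h' : dnbhs x [set y | forall i, `|g i (f y) - g i (f x)| < e].
  apply: (@dnbhs_forall _ _ _ (fun i => [set y | `|g i (f y) - g i (f x)| < e])).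
  by move=> i; apply: (@Cinf_continuous _ (g i \o f)) => //; exact/sf/Cinf_gen.
by apply: dnbhsS h' => y /h.
Qed.

(** Smoothness can be tested on generators: a function on [Y] is locally a
    smooth function of finitely many of them. *)
Lemma smooth_gens X Y (f : X -> Y) :
  (forall g, @dgens R Y g -> Cinf (g \o f)) -> smooth f.
Proof.
move=> gf h sh; apply: Cinf_local => x.
have [n [g [phi [gg sphi hh]]]] := sh (f x).
exists (fun y => phi (eval_row (fun i => g i \o f) y)).
  by apply: Cinf_comp => // i; exact: gf.
have h' : dnbhs x [set y | forall i, `|g i (f y) - g i (f x)| < 1].
  apply: (@dnbhs_forall _ _ _ (fun i => [set y | `|g i (f y) - g i (f x)| < 1])).
  move=> i; apply: (@Cinf_continuous _ (g i \o f)) => //; exact: gf.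
have cf N : dnbhs (f x) N -> dnbhs x (f @^-1` N).
  move=> [m [k [e [kk e0 hk]]]].
  have h'' : dnbhs x [set y | forall i, `|k i (f y) - k i (f x)| < e].
    apply: (@dnbhs_forall _ _ _ (fun i => [set y | `|k i (f y) - k i (f x)| < e])).
    by move=> i; apply: (@Cinf_continuous _ (k i \o f)) => //; exact: gf.
  by apply: dnbhsS h'' => y /hk.
exact: cf hh.
Qed.

Lemma smooth_comp X Y Z (f : X -> Y) (g : Y -> Z) :
  smooth f -> smooth g -> smooth (g \o f).
Proof. by move=> sf sg h sh; exact: (sf _ (sg _ sh)). Qed.

Lemma smooth_sval X (P : set X) : @smooth R (dsub P) X sval.
Proof. by move=> h sh; apply: Cinf_gen; exists h. Qed.

Lemma smooth_dsub X Y (P : set Y) (f : X -> dsub P) :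
  smooth (fun x => sval (f x) : Y) -> smooth f.
Proof. by move=> sf; apply: smooth_gens => _ [h sh ->]; exact: sf. Qed.

Lemma smooth_Rn X n (f : X -> Rn R n) :
  (forall i, Cinf (fun x => (f x : 'rV[R]_n) 0 i)) -> smooth f.
Proof. by move=> sf; apply: smooth_gens => _ [i ->]; exact: sf. Qed.

Lemma smooth_pair X Y Z (f : X -> Y) (g : X -> Z) :
  smooth f -> smooth g -> @smooth R X (dprod Y Z) (fun x => (f x, g x)).
Proof.
by move=> sf sg; apply: smooth_gens => _ [] [h sh ->]; [exact: sf|exact: sg].
Qed.

Lemma smooth_snd Y Z : @smooth R (dprod Y Z) Z snd.
Proof. by move=> h sh; apply: Cinf_gen; right; exists h. Qed.

Lemma Cinf_Rn_coord n (i : 'I_n) : @Cinf R (Rn R n) (fun u : 'rV[R]_n => u 0 i).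
Proof. by apply: Cinf_gen; exists i. Qed.

(** ** Germs *)

Definition Cinf_at X (f : X -> R) (x : X) :=
  exists2 g, Cinf g & dnbhs x [set y | f y = g y].

Lemma Cinf_atP X (f : X -> R) : (forall x, Cinf_at f x) <-> Cinf f.
Proof.
split=> [|sf x]; first exact: Cinf_local.
by exists f => //; apply: dnbhsS (dnbhsT x) => y _.
Qed.

Lemma Cinf_atM X (f g : X -> R) x :
  Cinf_at f x -> Cinf_at g x -> Cinf_at (fun y => f y * g y) x.
Proof.
move=> [f' sf ff] [g' sg gg]; exists (fun y => f' y * g' y); first exact: CinfM.
by apply: dnbhsS (dnbhsI ff gg) => y /= [-> ->].
Qed.

(** [1/t] agrees near [c] with the globally smooth function
    [t / (t ^ 2 + flat (c ^ 2 / 2 - t ^ 2))], where [flat] is positive exactly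
    on positive arguments. *)
Lemma Cinf_atV X (f : X -> R) x :
  Cinf_at f x -> f x != 0 -> Cinf_at (fun y => (f y)^-1) x.
Proof.
move=> [h sh fh]; rewrite (dnbhs_self fh) => h0.
have c0 : 0 < h x ^+ 2 / 2 by rewrite divr_gt0// exprn_even_gt0.
pose den (u : 'rV[R]_1) := u 0 0 * u 0 0 +
  flat_poly 1 (h x ^+ 2 / 2 + -1 * (u 0 0 * u 0 0)).
have flat_ge0 t : 0 <= flat_poly (1 : {poly R}) t.
  by rewrite /flat_poly; case: ifP => // _; rewrite hornerE mul1r expR_ge0.
have den0 u : den u != 0.
  have [u0|u0] := eqVneq (u 0 0) 0.
    rewrite /den u0 mul0r mulr0 add0r addr0 /flat_poly c0 hornerE mul1r.
    by rewrite gt_eqF// expR_gt0.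
  by rewrite gt_eqF// /den; apply: ltr_pwDl => //; rewrite -expr2 exprn_even_gt0.
have scoord : smooth_expr (fun u : 'rV[R]_1 => u 0 0) by exact: SmoothCoord.
have sden : smoothRn den.
  apply/smooth_exprP/SmoothAdd; first exact: SmoothMul.
  apply: SmoothFlat; apply/smooth_exprP/SmoothAdd; first exact: SmoothCst.
  by apply: SmoothMul; [exact: SmoothCst|exact: SmoothMul].
pose inv (u : 'rV[R]_1) := u 0 0 * (den u)^-1.
have sinv : smoothRn inv.
  by apply/smooth_exprP/SmoothMul => //; exact: SmoothInv.
exists (fun y => inv (eval_row (fun=> h) y)); first exact: Cinf_comp.
have hh : dnbhs x [set y | `|h y * h y - h x * h x| < h x ^+ 2 / 2].
  by apply: (@Cinf_continuous _ (fun y => h y * h y)) => //; exact: CinfM.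
apply: dnbhsS (dnbhsI fh hh) => y /= [-> hy].
rewrite /inv /den !mxE /flat_poly.
have hy' : h x ^+ 2 / 2 < h y * h y.
  by move: hy; rewrite ltr_norml => /andP[+ _]; rewrite !expr2; lra.
rewrite ifF; last by apply/negbTE; rewrite -leNgt mulN1r subr_le0 ltW.
have y0 : h y != 0.
  by apply: contraTneq hy' => ->; rewrite mulr0 -leNgt ltW.
by rewrite addr0 invfM mulrA divff// mul1r.
Qed.

(** ** Open subspaces and cutoff functions *)

Lemma dsub_dnbhs X (P : set X) (x : dsub P) K : dopen P ->
  dnbhs x K -> dnbhs (sval x) [set y | exists h : P y, K (exist _ y h)].
Proof.
move=> oP [n [g [e [gg e0 h]]]].
have [f fE] : {f : 'I_n -> X -> R &
    forall i, Cinf (f i) /\ g i = f i \o sval}.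
  apply: (@choice _ _ (fun i (f : X -> R) => Cinf f /\ g i = f \o sval)) => i.
  by have [f sf ->] := gg i; exists f.
have h' : dnbhs (sval x) [set y | forall i, `|f i y - f i (sval x)| < e].
  apply: (@dnbhs_forall _ _ _ (fun i => [set y | `|f i y - f i (sval x)| < e])).
  by move=> i; apply: Cinf_continuous => //; case: (fE i).
apply: dnbhsS (dnbhsI h' (oP _ (svalP x))) => y [hy Py]; exists Py; apply: h => i.
by have [_ ->] := fE i; exact: hy.
Qed.

(** The generators of a subspace are restrictions of functions smooth on the
    whole of [X], so a germ on an open subspace extends by the same formula. *)
Lemma Cinf_at_dsub X (P : set X) (f : X -> R) (x : dsub P) : dopen P ->
  @Cinf_at (dsub P) (fun y => f (sval y)) x -> Cinf_at f (sval x).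
Proof.
move=> oP [h sh fh]; have [n [g [phi [gg sphi hh]]]] := sh x.
have [k kE] : {k : 'I_n -> X -> R &
    forall i, Cinf (k i) /\ g i = k i \o sval}.
  apply: (@choice _ _ (fun i (f : X -> R) => Cinf f /\ g i = f \o sval)) => i.
  by have [k sk ->] := gg i; exists k.
exists (fun y => phi (eval_row k y)).
  by apply: Cinf_comp => // i; case: (kE i).
apply: dnbhsS (dsub_dnbhs oP (dnbhsI fh hh)) => y /= [Py [-> ->]].
by congr phi; apply/rowP => i; rewrite !mxE; have [_ ->] := kE i.
Qed.

(** On a ball [|g_i y - g_i x| < e] the function
    [flat (q - sum_i (g_i y - g_i x) ^ 2)] with [q < e ^ 2] vanishes near every
    point where some [|g_i y - g_i x| >= e].  The alternative in the conclusion,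
    rather than vanishing outside [N], makes products with functions smooth only
    on [N] smooth everywhere. *)
Lemma cutoff_exists X (x : X) N : dnbhs x N ->
  exists chi : X -> R, [/\ Cinf chi, chi x = 1 &
    forall y, N y \/ dnbhs y [set z | chi z = 0]].
Proof.
move=> [n [g [e [gg e0 h]]]].
pose rho y := \sum_(i < n) (g i y - g i x) * (g i y - g i x).
have srho : Cinf rho.
  apply: Cinf_sum => i; apply: CinfM; apply: CinfB; try exact: Cinf_cst;
  exact: Cinf_gen.
pose q := e ^+ 2 / 2.
have q0 : 0 < q by rewrite divr_gt0// exprn_gt0.
pose chi y := flat_poly (1 : {poly R}) (q - rho y) * (flat_poly 1 q)^-1.
have f0 : flat_poly (1 : {poly R}) q != 0.
  by rewrite /flat_poly q0 hornerE mul1r gt_eqF ?expR_gt0.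
exists chi; split.
- apply: CinfM; last exact: Cinf_cst.
  have sflat : smoothRn (fun u : 'rV[R]_1 => flat_poly 1 (u 0 0)).
    by apply/smooth_exprP/SmoothFlat; apply/smooth_exprP/SmoothCoord.
  have srow : forall i : 'I_1, Cinf (fun y => q - rho y).
    by move=> _; apply: CinfB => //; exact: Cinf_cst.
  by have := Cinf_comp sflat srow; under eq_fun do rewrite mxE.
- rewrite /chi (_ : rho x = 0) ?subr0 ?divff//.
  by rewrite /rho big1// => i _; rewrite subrr mul0r.
- move=> y; have [near_x|far_x] := pselect (forall i, `|g i y - g i x| < e).
    by left; exact: h.
  right; have rho_y : e ^+ 2 <= rho y.
    have [i] : exists i, ~ `|g i y - g i x| < e by apply/existsNP.
    move=> /negP; rewrite -leNgt => hi; rewrite /rho (bigD1 i)//=.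
    have : e ^+ 2 <= `|g i y - g i x| ^+ 2 by rewrite lerXn2r// nnegrE ltW.
    rewrite real_normK ?num_real// expr2 => /le_trans; apply.
    by rewrite lerDl sumr_ge0// => j _; rewrite -expr2 sqr_ge0.
  have := Cinf_continuous y srho q0.
  apply: dnbhsS => z /= hz; rewrite /chi /flat_poly ifF ?mul0r//.
  apply/negbTE; rewrite -leNgt; move: hz rho_y.
  by rewrite ltr_norml => /andP[+ _]; rewrite /q; lra.
Qed.

Lemma Cinf_cutoffM X (N : set X) (chi f : X -> R) :
  Cinf chi -> (forall y, N y \/ dnbhs y [set z | chi z = 0]) ->
  (forall y, N y -> Cinf_at f y) -> Cinf (fun y => chi y * f y).
Proof.
move=> schi hchi sf; apply/Cinf_atP => y; have [Ny|chi0] := hchi y.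
  by apply: Cinf_atM; [move/Cinf_atP : schi|exact: sf].
exists (fun=> 0); first exact: Cinf_cst.
by apply: dnbhsS chi0 => z /= ->; rewrite mul0r.
Qed.

End Spaces.

(** * Tangent vectors *)
Section Tangents.
Variable R : realType.
Implicit Types X Y : diffSpace R.

Lemma tangentP X (x : X) (u : tangent x) : is_derivation x u.
Proof. by apply/asboolP; exact: (tvalP u). Qed.

Lemma der_chain X (x : X) (u : tangent x) n (phi : 'rV[R]_n -> R)
    (f : 'I_n -> X -> R) : smoothRn phi -> (forall i, Cinf (f i)) ->
  u (fun y => phi (eval_row f y)) =
  \sum_(i < n) partial i phi (eval_row f x) * u (f i).
Proof. by case: (tangentP u) => + _; exact. Qed.

Lemma der_notCinf X (x : X) (u : tangent x) f : ~ Cinf f -> u f = 0.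
Proof. by case: (tangentP u) => _; exact. Qed.

Lemma der_cst X (x : X) (u : tangent x) c : u (fun=> c) = 0.
Proof.
have := @der_chain _ _ u 0 (fun=> c) (fun=> cst 0).
rewrite big_ord0; apply => [|[]//]; exact/smooth_exprP/SmoothCst.
Qed.

Lemma der_add X (x : X) (u : tangent x) f g : Cinf f -> Cinf g ->
  u (fun y => f y + g y) = u f + u g.
Proof.
move=> sf sg.
have sphi : smoothRn (fun v : 'rV[R]_2 => v 0 0 + v 0 1).
  by apply/smooth_exprP/SmoothAdd; exact: SmoothCoord.
have sfg (i : 'I_2) : Cinf (if i == 0 then f else g) by case: ifP.
have := der_chain u sphi sfg.
rewrite [X in u X](_ : _ = fun y => f y + g y); last first.
  by apply/funext => y; rewrite !mxE.
move=> ->; rewrite !big_ord_recl big_ord0 /= addr0.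
have dphi i z : partial i (fun v : 'rV[R]_2 => v 0 0 + v 0 1) z =
    (i == 0)%:R + (i == 1)%:R.
  rewrite -!(partial_coord _ _ z); apply: deriveD;
  by apply: diff_derivable; exact: differentiable_coord.
by rewrite !dphi /= addr0 add0r !mul1r.
Qed.

Lemma der_mul X (x : X) (u : tangent x) f g : Cinf f -> Cinf g ->
  u (fun y => f y * g y) = f x * u g + g x * u f.
Proof.
move=> sf sg.
have sphi : smoothRn (fun v : 'rV[R]_2 => v 0 0 * v 0 1).
  by apply/smooth_exprP/SmoothMul; exact: SmoothCoord.
have sfg (i : 'I_2) : Cinf (if i == 0 then f else g) by case: ifP.
have := der_chain u sphi sfg.
rewrite [X in u X](_ : _ = fun y => f y * g y); last first.
  by apply/funext => y; rewrite !mxE.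
move=> ->; rewrite !big_ord_recl big_ord0 /= addr0.
have dphi i z : partial i (fun v : 'rV[R]_2 => v 0 0 * v 0 1) z =
    z 0 0 * (i == 1)%:R + z 0 1 * (i == 0)%:R.
  rewrite -!(partial_coord _ _ z); apply: deriveM;
  by apply: diff_derivable; exact: differentiable_coord.
by rewrite !dphi !mxE /= !mulr0 !mulr1 addr0 add0r addrC.
Qed.

Lemma der_scale X (x : X) (u : tangent x) c f : Cinf f ->
  u (fun y => c * f y) = c * u f.
Proof.
by move=> sf; rewrite der_mul ?der_cst ?mulr0 ?addr0//; exact: Cinf_cst.
Qed.

Lemma der_sum X (x : X) (u : tangent x) n (f : 'I_n -> X -> R) :
  (forall i, Cinf (f i)) ->
  u (fun y => \sum_(i < n) f i y) = \sum_(i < n) u (f i).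
Proof.
elim: n f => [|n IH] f sf.
  by rewrite big_ord0; under eq_fun do rewrite big_ord0; rewrite der_cst.
rewrite big_ord_recl -IH//; under eq_fun do rewrite big_ord_recl.
by rewrite der_add//; exact: Cinf_sum.
Qed.

(** Multiplying by a cutoff function equal to [1] at [x] turns functions that
    agree near [x] into equal ones. *)
Lemma der_local X (x : X) (u : tangent x) f g : Cinf f -> Cinf g ->
  dnbhs x [set y | f y = g y] -> u f = u g.
Proof.
move=> sf sg fg; have [chi [schi chi1 hchi]] := cutoff_exists fg.
have fgx : f x = g x := dnbhs_self fg.
have eq_chi : (fun y => chi y * f y) = (fun y => chi y * g y).
  apply/funext => y; have [/= -> //|chi0] := hchi y.
  by have -> : chi y = 0 := dnbhs_self chi0; rewrite !mul0r.
have : u (fun y => chi y * f y) = u (fun y => chi y * g y) by rewrite eq_chi.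
by rewrite !der_mul// fgx chi1 !mul1r => /addIr.
Qed.

(** The generators and the smooth function are the same at all points near [x],
    hence [U h] is smooth as soon as [U] is smooth on generators. *)
Lemma der_gens X Y (F : X -> Y) x h : smooth F -> Cinf h ->
  exists n (g : 'I_n -> Y -> R) (phi : 'rV[R]_n -> R),
    [/\ forall i, dgens (g i), smoothRn phi &
      dnbhs x [set y | forall u : tangent y, u (h \o F) =
        \sum_(i < n) partial i phi (eval_row g (F y)) * u (g i \o F)]].
Proof.
move=> sF sh; have [n [g [phi [gg sphi hh]]]] := sh (F x).
exists n, g, phi; split => //.
apply: dnbhsS (dnbhs_interior (smooth_dnbhs sF hh)) => y /= hy u.
have sgF i : Cinf (g i \o F) by exact/sF/Cinf_gen.
rewrite -[eval_row g (F y)]/(eval_row (fun i => g i \o F) y) -der_chain//.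
by apply: der_local => //; [exact: sF|exact: Cinf_comp].
Qed.

(** With [F] the identity or an inclusion, tangent vectors are determined by
    their values on generators. *)
Lemma der_eq_gens X Y (F : X -> Y) x (u v : tangent x) : smooth F ->
  (forall g, @dgens R Y g -> u (g \o F) = v (g \o F)) ->
  forall h, Cinf h -> u (h \o F) = v (h \o F).
Proof.
move=> sF uv h sh; have [n [g [phi [gg sphi /dnbhs_self hx]]]] := der_gens x sF sh.
by rewrite !hx; apply: eq_bigr => i _; rewrite uv.
Qed.

Lemma tangent_eq X (x : X) (u v : tangent x) :
  (forall f, Cinf f -> u f = v f) -> u = v.
Proof.
move=> uv; apply/val_inj/funext => f /=.
by have [/uv//|nf] := pselect (Cinf f); rewrite !der_notCinf.
Qed.

Lemma tangent_eq_dsub Y (P : set Y) (x : dsub P) (u v : tangent x) :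
  (forall g, @dgens R Y g -> u (g \o sval) = v (g \o sval)) -> u = v.
Proof.
move=> uv; apply: tangent_eq => f sf.
apply: (@der_eq_gens (dsub P) (dsub P) id) => // _ [g sg ->].
exact: (der_eq_gens (@smooth_sval _ _ P)).
Qed.

Lemma Cinf_der_gens X Y (F : X -> Y) (U : vfield X) : smooth F ->
  (forall g, @dgens R Y g -> Cinf (fun x => U x (g \o F))) ->
  forall h, Cinf h -> Cinf (fun x => U x (h \o F)).
Proof.
move=> sF sU h sh; apply: Cinf_local => x.
have [n [g [phi [gg sphi hx]]]] := der_gens x sF sh.
exists (fun y => \sum_(i < n)
    partial i phi (eval_row (fun i => g i \o F) y) * U y (g i \o F)).
  apply: Cinf_sum => i; apply: CinfM; last exact: sU.
  apply: Cinf_comp; first exact: smoothRn_partial.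
  by move=> j; exact/sF/Cinf_gen.
by apply: dnbhsS hx => y /= ->.
Qed.

Lemma smooth_vfield_Cinf X (U : vfield X) f :
  smooth_vfield U -> Cinf f -> Cinf (fun x => U x f).
Proof.
move=> sU sf; apply: (sU (fun w : {x : X & tangent x} => projT2 w f)).
by apply: Cinf_gen; right; exists f.
Qed.

Lemma smooth_vfieldP X (U : vfield X) :
  (forall f, Cinf f -> Cinf (fun x => U x f)) -> smooth_vfield U.
Proof. by move=> sU; apply: smooth_gens => _ [] [f sf ->] //; exact: sU. Qed.

Lemma smooth_vfield_dsub Y (P : set Y) (U : vfield (dsub P)) :
  (forall g, @dgens R Y g -> Cinf (fun x => U x (g \o sval))) ->
  smooth_vfield U.
Proof.
move=> sU; apply: smooth_vfieldP => f sf.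
apply: (@Cinf_der_gens (dsub P) (dsub P) id) => // _ [g sg ->].
exact: (Cinf_der_gens (@smooth_sval _ _ P)).
Qed.

(** [to_tangent x w] is [w] if [w] obeys the chain rule, and [0] otherwise; so an
    equation that also holds for [0] can be read off from [w] in either case. *)
Lemma to_tangent_or X (x : X) w f : Cinf f ->
  to_tangent x w f = w f \/ to_tangent x w f = 0.
Proof.
move=> sf; rewrite /to_tangent /insubd.
by case: insubP => [u _ /= -> |_]; [left; rewrite asboolT|right].
Qed.

Lemma lie_bracket_or X (U W : vfield X) x f : Cinf f ->
  lie_bracket U W x f = U x (fun y => W y f) - W x (fun y => U y f) \/
  lie_bracket U W x f = 0.
Proof. exact: to_tangent_or. Qed.

Lemma to_tangentE X (x : X) w f :
  (forall n (phi : 'rV[R]_n -> R) (f : 'I_n -> X -> R),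
     smoothRn phi -> (forall i, Cinf (f i)) ->
     w (fun y => phi (eval_row f y)) =
     \sum_(i < n) partial i phi (eval_row f x) * w (f i)) ->
  Cinf f -> to_tangent x w f = w f.
Proof.
move=> dw sf; rewrite /to_tangent /insubd insubT /=; last by rewrite asboolT.
apply/asboolP; split=> [n phi h sphi sh|h nh]; last by rewrite asboolF.
rewrite asboolT ?dw//; last exact: Cinf_comp.
by apply: eq_bigr => i _; rewrite asboolT.
Qed.

Lemma tangent_mapE X Y (f : X -> Y) x (v : tangent x) h :
  smooth f -> Cinf h -> tangent_map f v h = v (h \o f).
Proof.
move=> sf; apply: to_tangentE => n phi g sphi sg.
exact: (@der_chain _ _ v n phi (fun i => g i \o f) sphi (fun i => sf _ (sg i))).
Qed.

(** ** Velocities of curves *)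
Section Curves.
Variables (X : diffSpace R) (c : R -> X).
Hypothesis dc : forall g, @dgens R X g -> differentiable (g \o c) (0 : R).

(** Differentiability of the generators along [c] makes [c] continuous at [0]. *)
Lemma curve_near N : dnbhs (c 0) N -> \forall t \near (0 : R), N (c t).
Proof.
move=> [n [g [e [gg e0 h]]]].
have hn : \forall t \near (0 : R), forall i, `|g i (c t) - g i (c 0)| < e.
  suff hi i : \forall t \near (0 : R), `|g i (c t) - g i (c 0)| < e.
    exact: (@filter_forall _ _ (fun i t => `|g i (c t) - g i (c 0)| < e) _ _ hi).
  have /differentiable_continuous/cvgrPdist_lt/(_ _ e0) := dc (gg i).
  by apply: filterS => t; rewrite distrC.
by apply: filterS hn => t; exact: h.
Qed.

Lemma curve_diff h : Cinf h -> differentiable (h \o c) (0 : R).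
Proof.
move=> sh; have [n [g [phi [gg sphi hh]]]] := sh (c 0).
have [dphi _] := @chain_rule R R n (fun i => g i \o c) phi 0 1
  (fun i => dc (gg i)) (smoothRn_diff _ sphi).
apply/derivable1_diffP; move/derivable1_diffP : dphi.
move=> dphi; apply: near_eq_derivable dphi.
by apply: filterS (curve_near hh) => t /= ->.
Qed.

Lemma curve_chain n (phi : 'rV[R]_n -> R) (f : 'I_n -> X -> R) :
  smoothRn phi -> (forall i, Cinf (f i)) ->
  derive1 ((fun y => phi (eval_row f y)) \o c) 0 =
  \sum_(i < n) partial i phi (eval_row f (c 0)) * derive1 (f i \o c) 0.
Proof.
move=> sphi sf; rewrite derive1E.
have [_ ->] := @chain_rule R R n (fun i => f i \o c) phi 0 1
  (fun i => curve_diff (sf i)) (smoothRn_diff _ sphi).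
by apply: eq_bigr => i _; rewrite derive1E.
Qed.

End Curves.

End Tangents.

(** * Affine bundles and their frames *)
Lemma existT_inj (I : Type) (T : I -> Type) i (a b : T i) :
  existT T i a = existT T i b -> a = b.
Proof.
by move=> ab; have := projT2_eq ab; rewrite (Prop_irrelevance (projT1_eq ab) erefl).
Qed.

Lemma linear_sumZ (R : realType) (U W : lmodType R) (f : U -> W) n
    (c : 'I_n -> R) (v : 'I_n -> U) : linear f ->
  f (\sum_(i < n) c i *: v i) = \sum_(i < n) c i *: f (v i).
Proof.
move=> lf; pose g : {linear U -> W} := HB.pack f (GRing.isLinear.Build _ _ _ _ f lf).
rewrite -[f]/(g : U -> W) linear_sum.
by apply: eq_bigr => i _; rewrite linearZ.
Qed.

Section Frames.
Variables (R : realType) (M : diffSpace R) (V : vbundle M) (A : abundle V).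
Local Notation At := (Atilde A).
Hypothesis affA : is_affine_bundle A.

Lemma pairing_add m (al be : adual A m) (z : At m) :
  pairing (al + be) z = pairing al z + pairing be z.
Proof.
have /asboolP lz := abidual_valP z.
by have := lz 1 al be; rewrite !scale1r.
Qed.

Lemma pairing_scale m c (al : adual A m) (z : At m) :
  pairing (c *: al) z = c * pairing al z.
Proof.
have /asboolP lz := abidual_valP z.
have z0 : pairing 0 z = 0.
  have := lz (-1) 0 0; rewrite scaler0 addr0 => h.
  by rewrite /pairing {1}h scaleN1r addNr.
have := lz c al 0; rewrite !addr0 => h.
by rewrite /pairing h -/(pairing 0 z) z0 addr0.
Qed.

Lemma pairing0 m (z : At m) : pairing 0 z = 0.
Proof. by rewrite -[0](scale0r 0) pairing_scale mul0r. Qed.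

Lemma pairing_sum m n (al : 'I_n -> adual A m) (z : At m) :
  pairing (\sum_(i < n) al i) z = \sum_(i < n) pairing (al i) z.
Proof.
elim: n al => [|n IH] al; first by rewrite !big_ord0 pairing0.
by rewrite !big_ord_recl pairing_add IH.
Qed.

Lemma pairing_addr m (al : adual A m) (z z' : At m) :
  pairing al (z + z') = pairing al z + pairing al z'.
Proof. by []. Qed.

Lemma pairing_subr m (al : adual A m) (z z' : At m) :
  pairing al (z - z') = pairing al z - pairing al z'.
Proof. by []. Qed.

Lemma pairing_scaler m (al : adual A m) c (z : At m) :
  pairing al (c *: z) = c * pairing al z.
Proof. by []. Qed.

Lemma pairing_sumr m (al : adual A m) n (z : 'I_n -> At m) :
  pairing al (\sum_(i < n) z i) = \sum_(i < n) pairing al (z i).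
Proof.
elim: n z => [|n IH] z; first by rewrite !big_ord0.
by rewrite !big_ord_recl pairing_addr IH.
Qed.

Lemma pairing_aeval m (al : adual A m) (a : A m) : pairing al (aeval a) = al a.
Proof. by []. Qed.

Lemma At_eq m (z z' : At m) : (forall al, pairing al z = pairing al z') -> z = z'.
Proof. by move=> h; apply/val_inj/funext => al; exact: h. Qed.

Lemma adual_eq m (al be : adual A m) : (forall a, al a = be a) -> al = be.
Proof. by move=> h; apply/val_inj/funext => a; exact: h. Qed.

Lemma aproj_smooth : smooth (@aproj R M V A).
Proof. by case: affA. Qed.

Lemma local_map_inj (T : M -> Type) (N : set M) r (Phi : forall m, T m -> 'rV[R]_r)
    f' m : cancel (@local_map R M T N r Phi) f' -> N m -> injective (Phi m).
Proof.
move=> fK Nm a b ab; apply: (@existT_inj _ T).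
pose w c : {z : {m : M & T m} | over N z} := exist _ (existT T m c) Nm.
have ww : w a = w b.
  apply: (can_inj fK); rewrite /local_map /w /= ab; congr (exist _ _ _, _).
  exact: Prop_irrelevance.
exact: (congr1 sval ww).
Qed.

Lemma local_map_surj (T : M -> Type) (N : set M) r (Phi : forall m, T m -> 'rV[R]_r)
    f' m x : cancel f' (@local_map R M T N r Phi) -> N m -> exists a, Phi m a = x.
Proof.
move=> fK Nm; have := fK (exist _ m Nm, x).
case: (f' _) => -[m1 a1] h1 h.
have e1 : m1 = m := congr1 (fun p => sval p.1) h.
by have e2 : Phi m1 a1 = x := congr1 snd h; subst m1; exists a1.
Qed.

Lemma affine_fibre_inhabited m : exists a : A m, True.
Proof.
have [_ _ _ _ /(_ m)[N [r [Phi [phi [_ Nm _ _ [f' [_ _ _ fK]]]]]]]] := affA.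
by have [a _] := local_map_surj 0 fK Nm; exists a.
Qed.

Definition base_point m : A m := sval (cid (affine_fibre_inhabited m)).

Definition ev (beta : dsection A (fun m : M => m)) (z : vtot At) : R :=
  pairing (beta (projT1 z)) (projT2 z).

Definition eps (z : vtot At) : R := ev (e0 A) z.

Lemma smooth_e0 (X : diffSpace R) (q : X -> M) : smooth_dsection (fun x => e0 A (q x)).
Proof. exact: Cinf_cst. Qed.

Lemma Cinf_ev beta : smooth_dsection beta -> Cinf (ev beta).
Proof. by move=> sb; apply: Cinf_gen; right; exists beta. Qed.

Lemma Cinf_eps : Cinf eps.
Proof. exact/Cinf_ev/smooth_e0. Qed.

Lemma smooth_vproj : smooth (@vproj R M At).
Proof. by move=> f sf; apply: Cinf_gen; left; exists f. Qed.

Lemma smooth_to_vtot (X : diffSpace R) (F : X -> vtot At) :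
  smooth (fun x => projT1 (F x) : M) ->
  (forall beta, smooth_dsection beta -> Cinf (fun x => ev beta (F x))) ->
  smooth F.
Proof.
move=> s1 s2; apply: smooth_gens => _ [] [f sf ->]; first exact: s1.
exact: s2.
Qed.

(** The pullback of [A] along the identity is diffeomorphic to [A] by
    [(m, a) |-> a]. *)
Lemma smooth_dsectionP (beta : dsection A (fun m : M => m)) :
  smooth_dsection beta <->
  @Cinf R (atot A) (fun a => beta (projT1 a) (projT2 a)).
Proof.
split=> sb.
  pose k (a : atot A) : pullback_A A (fun m : M => m) :=
    existT _ (projT1 a) (projT2 a).
  suff sk : smooth k by exact: (sk _ sb).
  apply: smooth_gens => _ [] [f sf ->]; first exact: (aproj_smooth sf).
  by rewrite (_ : _ \o _ = f)//; apply/funext => -[].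
pose j (w : pullback_A A (fun m : M => m)) : atot A :=
  existT _ (projT1 w) (projT2 w).
suff sj : smooth j by exact: (sj _ sb).
by move=> f sf; apply: Cinf_gen; right; exists f.
Qed.

Definition chart (N : set M) r (Phi : forall m, A m -> 'rV[R]_r)
    (phi : forall m, V m -> 'rV[R]_r) : Prop :=
  [/\ dopen N, forall m, N m -> linear (phi m),
      forall m, N m -> forall a v, Phi m (atr a v) = Phi m a + phi m v &
      @diffeomorphism R (dsub (over N : set (atot A)))
        (dprod (dsub N) (Rn R r)) (local_map Phi)].

Lemma chart_exists m : exists N r (Phi : forall m, A m -> 'rV[R]_r)
  (phi : forall m, V m -> 'rV[R]_r), N m /\ chart N Phi phi.
Proof.
have [_ _ _ _ /(_ m)[N [r [Phi [phi [oN Nm [lphi _] aPhi dPhi]]]]]] := affA.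
by exists N, r, Phi, phi.
Qed.

Section Chart.
Variables (N : set M) (r : nat) (Phi : forall m, A m -> 'rV[R]_r)
  (phi : forall m, V m -> 'rV[R]_r).
Hypothesis cPhi : chart N Phi phi.

Definition pt (m : M) (x : 'rV[R]_r) : A m :=
  if pselect (exists a, Phi a = x :> 'rV[R]_r) is left h then sval (cid h)
  else base_point m.
Arguments pt : clear implicits.

Lemma Phi_pt m x : N m -> Phi (pt m x) = x.
Proof.
move=> Nm; have [_ _ _ [f' [_ _ _ fK]]] := cPhi.
have [a ax] := local_map_surj x fK Nm.
rewrite /pt; case: pselect => [h|[]]; last by exists a.
exact: (svalP (cid h)).
Qed.

Lemma pt_Phi m (a : A m) : N m -> pt m (Phi a) = a.
Proof.
move=> Nm; have [_ _ _ [f' [_ _ fK _]]] := cPhi.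
by apply: (local_map_inj fK Nm); exact: Phi_pt.
Qed.

(** The coefficients of the linear part of an affine function in the chart; the
    value at [pt m 0] is its constant term. *)
Definition slope m (al : adual A m) (i : 'I_r) : R :=
  al (pt m (delta_mx 0 i)) - al (pt m 0).

Lemma slopeP m c (al be : adual A m) i :
  slope (c *: al + be) i = c * slope al i + slope be i.
Proof.
rewrite /slope; transitivity (c * al (pt m (delta_mx 0 i)) + be (pt m (delta_mx 0 i))
  - (c * al (pt m 0) + be (pt m 0))); first by [].
by ring.
Qed.

(** Write [a = o + v] with [o = pt m 0].  The vectors [v_i] from [o] to
    [pt m e_i] are mapped by [phi] to the standard basis, so
    [v = sum_i (Phi a)_i v_i]. *)
Lemma adual_chart m (al : adual A m) (a : A m) : N m ->
  al a = al (pt m 0) + \sum_(i < r) slope al i * Phi a 0 i.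
Proof.
move=> Nm; have [tr0 trD trE _ _] := affA; have [_ lphi aPhi _] := cPhi.
have /asboolP[l lP] := adual_valP al.
have Phi0 : Phi (pt m 0) = 0 := Phi_pt 0 Nm.
have [v vE] : {v : 'I_r -> V m & forall i, atr (pt m 0) (v i) = pt m (delta_mx 0 i)}.
  apply: (@choice _ _ (fun i v => atr (pt m 0) v = pt m (delta_mx 0 i))) => i.
  by have [v [vE _]] := trE m (pt m 0) (pt m (delta_mx 0 i)); exists v.
have phiv i : phi (v i) = delta_mx 0 i.
  by have := aPhi m Nm (pt m 0) (v i); rewrite vE Phi_pt// Phi0 add0r.
have aE : atr (pt m 0) (\sum_(i < r) Phi a 0 i *: v i) = a.
  rewrite -[LHS]pt_Phi// -[RHS]pt_Phi// aPhi// Phi0 add0r linear_sumZ; last exact: lphi.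
  congr pt; rewrite [RHS]row_sum_delta; apply: eq_bigr => i _.
  by rewrite phiv.
rewrite -{1}aE lP linear_sum; congr (_ + _); apply: eq_bigr => i _.
by rewrite linearZ /= /slope -vE lP addrAC subrr add0r mulrC.
Qed.

Section Cutoff.
Variable chi : M -> R.
Hypothesis chiN : forall y, N y \/ dnbhs y [set z | chi z = 0].
Hypothesis schi : Cinf chi.

Lemma chi_out m : chi m != 0 -> N m.
Proof. by case: (chiN m) => // /dnbhs_self ->; rewrite eqxx. Qed.

Lemma cut_coord_subproof i m :
  (fun a : A m => chi m * Phi a 0 i : R^o) \in @affine_functions R M V A m.
Proof.
have [_ lphi aPhi _] := cPhi.
apply/asboolP; have [c0|/chi_out Nm] := eqVneq (chi m) 0.
  by exists (\0 : {linear V m -> R^o}) => a v; rewrite c0 !mul0r addr0.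
pose f (v : V m) : R^o := chi m * phi v 0 i.
have lf : linear f.
  move=> c u v; rewrite /f lphi// !mxE mulrDr mulrCA //.
exists (HB.pack f (GRing.isLinear.Build _ _ _ _ f lf) : {linear V m -> R^o}).
by move=> a v /=; rewrite aPhi// mxE mulrDr.
Qed.

(** The coordinate functions of the chart, multiplied by a cutoff function to
    become global sections of the dual bundle. *)
Definition cut_coord i : dsection A (fun m : M => m) :=
  fun m => ADual (cut_coord_subproof i m).

Lemma smooth_cut_coord i : smooth_dsection (cut_coord i).
Proof.
have [oN _ _ [f' [sPhi _ _ _]]] := cPhi.
apply/smooth_dsectionP => /=.
apply: (@Cinf_cutoffM _ (atot A) (over N) (fun a => chi (projT1 a))
  (fun a => Phi (projT2 a) 0 i)).
- exact: (aproj_smooth schi).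
- move=> a; have [|h] := chiN (projT1 a); first by left.
  by right; exact: (smooth_dnbhs aproj_smooth h).
- move=> a Na; pose b : dsub (over N : set (atot A)) := exist _ a Na.
  have oNA : dopen (over N : set (atot A)).
    by move=> c Nc; exact: (smooth_dnbhs aproj_smooth (oN _ Nc)).
  apply: (@Cinf_at_dsub _ _ _ _ b oNA).
  move: b; apply/Cinf_atP.
  exact: (smooth_comp sPhi (@smooth_snd _ _ _) (Cinf_Rn_coord i)).
Qed.

(** The cutoff function makes the expansion in the local frame
    [e0, Phi_1, ..., Phi_r] a global identity. *)
Lemma cut_adual m (al : adual A m) :
  chi m *: al =
  (chi m * al (pt m 0)) *: e0 A m + \sum_(i < r) slope al i *: cut_coord i m.
Proof.
apply: adual_eq => a.
have addE (x y : adual A m) : (x + y) a = x a + y a by [].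
have scaleE c (x : adual A m) : (c *: x) a = c * x a by [].
have sumE n (F : 'I_n -> adual A m) :
    (\sum_(i < n) F i) a = \sum_(i < n) F i a.
  by elim: n F => [|n IH] F; rewrite ?big_ord0// !big_ord_recl addE IH.
have cutE i : cut_coord i m a = chi m * Phi a 0 i by [].
rewrite addE sumE !scaleE [e0 A m a]/(1 : R) mulr1.
under [X in _ = _ + X]eq_bigr do rewrite scaleE cutE.
have [c0|/chi_out Nm] := eqVneq (chi m) 0.
  rewrite c0 !mul0r add0r big1// => i _.
  by rewrite mul0r mulr0.
rewrite (adual_chart al a Nm) mulrDr mulr_sumr; congr (_ + _).
by apply: eq_bigr => i _; rewrite mulrCA.
Qed.

Lemma cut_pairing m (al : adual A m) (z : At m) :
  chi m * pairing al z = chi m * al (pt m 0) * pairing (e0 A m) z +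
    \sum_(i < r) slope al i * pairing (cut_coord i m) z.
Proof.
rewrite -pairing_scale cut_adual pairing_add pairing_scale pairing_sum.
by congr (_ + _); apply: eq_bigr => i _; rewrite pairing_scale.
Qed.

(** [m |-> pt m x] is a local section of [A], namely the inverse of the chart
    along [N x {x}]. *)
Lemma smooth_cut_pt x (beta : dsection A (fun m : M => m)) :
  smooth_dsection beta -> Cinf (fun m => chi m * beta m (pt m x)).
Proof.
move=> /smooth_dsectionP sb; have [oN _ _ [f' [_ sf' _ fK]]] := cPhi.
apply: (@Cinf_cutoffM _ M N) => // m Nm.
apply: (@Cinf_at_dsub _ _ _ _ (exist _ m Nm : dsub N) oN).
move: (exist _ m Nm : dsub N); apply/Cinf_atP.
have s1 : @smooth R (dsub N) (dprod (dsub N) (Rn R r)) (fun y => (y, x)).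
  apply: smooth_pair; first by move=> h sh.
  by apply: smooth_Rn => i; exact: Cinf_cst.
have := smooth_comp (smooth_comp s1 sf') (@smooth_sval _ _ _) sb.
rewrite (_ : _ \o _ = fun y : dsub N => beta (sval y) (pt (sval y) x))//.
apply/funext => y /=; have := fK (y, x); case: (f' _) => -[m1 a1] h1 h.
have e1 : sval y = m1 := esym (congr1 (fun p => sval p.1) h).
have e2 : x = Phi a1 := esym (congr1 snd h).
by rewrite e1 e2 pt_Phi.
Qed.

Lemma smooth_cut_slope i (beta : dsection A (fun m : M => m)) :
  smooth_dsection beta -> Cinf (fun m => chi m * slope (beta m) i).
Proof.
move=> sb; rewrite /slope; under eq_fun do rewrite mulrBr.
by apply: CinfB; exact: smooth_cut_pt.
Qed.

(** Both sides have the same pairing with [e0] and with the coordinates. *)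
Lemma cut_inA m (z : At m) : chi m != 0 -> pairing (e0 A m) z = 1 ->
  z = aeval (pt m (\row_i (pairing (cut_coord i m) z / chi m))).
Proof.
move=> c0 z1; have Nm := chi_out c0; apply: At_eq => al; apply: (mulfI c0).
rewrite !cut_pairing z1 pairing_aeval; congr (_ + _); apply: eq_bigr => i _.
by rewrite pairing_aeval /= Phi_pt// mxE [chi m * _]mulrCA divff// mulr1.
Qed.

End Cutoff.

End Chart.

Lemma cut_chart_exists m : exists N r (Phi : forall m, A m -> 'rV[R]_r)
  (phi : forall m, V m -> 'rV[R]_r) (chi : M -> R),
  [/\ chart N Phi phi, Cinf chi, chi m = 1 &
      forall y, N y \/ dnbhs y [set z | chi z = 0]].
Proof.
have [N [r [Phi [phi [Nm cPhi]]]]] := chart_exists m.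
have [oN _ _ _] := cPhi.
have [chi [schi chi1 chiN]] := cutoff_exists (oN _ Nm).
by exists N, r, Phi, phi, chi.
Qed.

Lemma pairing1_inA m (z : At m) : pairing (e0 A m) z = 1 -> inA z.
Proof.
have [N [r [Phi [phi [chi [cPhi _ chi1 chiN]]]]]] := cut_chart_exists m.
move=> z1; eexists; apply: (cut_inA cPhi chiN _ z1).
by rewrite chi1 oner_neq0.
Qed.

(** Adding a point of [A] moves the level [0] of [e0] to its level [1]. *)
Lemma pairing0_inV m (z : At m) : pairing (e0 A m) z = 0 -> inV z.
Proof.
move=> z0; have [_ _ trE _ _] := affA; pose a := base_point m.
have [b bE] : inA (z + aeval a).
  by apply: pairing1_inA; rewrite pairing_addr z0 add0r.
by have [v [vE _]] := trE m a b; exists a, v; rewrite vE -bE addrK.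
Qed.

Lemma inV_pairing0 m (z : At m) : inV z -> pairing (e0 A m) z = 0.
Proof.
by move=> [a [v ->]]; rewrite pairing_subr !pairing_aeval /= subrr.
Qed.

Lemma inA_pairing1 m (z : At m) : inA z -> pairing (e0 A m) z = 1.
Proof. by move=> [a ->]. Qed.

End Frames.

Arguments smooth_e0 {R M V} A {X} q.
Arguments Cinf_eps {R M V} A.

(** * The punctured bidual bundle *)
Section Linearized.
Variables (R : realType) (M : diffSpace R) (V : vbundle M) (A : abundle V).
Local Notation At := (Atilde A).
Local Notation OffV := (dsub (@offV R M V A)).
Hypothesis affA : is_affine_bundle A.

Lemma dsub_eq (X : diffSpace R) (P : set X) (x y : dsub P) :
  sval x = sval y -> x = y.
Proof.
by case: x y => x Px [y Py] /= xy; subst y; rewrite (Prop_irrelevance Px Py).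
Qed.

Lemma offVP (z : vtot At) : offV z <-> eps z != 0.
Proof.
split=> [nz|]; first by apply/eqP => /(pairing0_inV affA).
by move=> /eqP e0z /inV_pairing0.
Qed.

Lemma eps_neq0 (z : OffV) : eps (sval z) != 0.
Proof. by apply/offVP; exact: (svalP z). Qed.

Lemma aeval_inj m : injective (@aeval R M V A m).
Proof.
have [N [r [Phi [phi [chi [cPhi schi chi1 chiN]]]]]] := cut_chart_exists affA m.
have c0 : chi m != 0 by rewrite chi1 oner_neq0.
have Nm := chi_out chiN c0.
move=> a b ab; rewrite -(pt_Phi affA cPhi a Nm) -(pt_Phi affA cPhi b Nm).
congr pt; apply/rowP => i; apply: (mulfI c0).
exact: (congr1 (pairing (cut_coord cPhi chiN i m)) ab).
Qed.

Lemma retract_subproof (z : OffV) :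
  exists a : A (bproj z), projT2 (sval z) = eps (sval z) *: aeval a.
Proof.
have [a aE] : inA ((eps (sval z))^-1 *: projT2 (sval z)).
  by apply: pairing1_inA => //; rewrite pairing_scaler mulVf// eps_neq0.
by exists a; rewrite -aE scalerA divff ?eps_neq0// scale1r.
Qed.

(** The point of [A] on the line through [z].  The base point is kept as
    [bproj z], so that sections over [A] pull back without transport. *)
Definition retract (z : OffV) : atot A :=
  existT _ (bproj z) (sval (cid (retract_subproof z))).

Lemma retractE (z : OffV) :
  projT2 (sval z) = eps (sval z) *: aeval (projT2 (retract z)).
Proof. exact: (svalP (cid (retract_subproof z))). Qed.

Lemma retract_inclusion (a : atot A) : retract (inclusion a) = a.
Proof.
case: a => m a; congr existT; apply: aeval_inj.
have aE : aeval a = 1 *: aeval (projT2 (retract (inclusion (existT _ m a)))).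
  exact: (retractE (inclusion (existT _ m a))).
by rewrite scale1r in aE.
Qed.

Lemma dilation_retract (z : OffV) : dilation (eps_neq0 z) (retract z) = z.
Proof.
apply: dsub_eq; have := retractE z; rewrite /dilation /=.
by case: z => -[m z] h /= <-.
Qed.

Lemma bproj_smooth : smooth (@bproj R M At (@offV R M V A)).
Proof. exact: (smooth_comp (@smooth_sval _ _ _) (@smooth_vproj _ _ _ A)). Qed.

Lemma smooth_aeval :
  @smooth R (atot A) (vtot At) (fun a => existT _ (projT1 a) (aeval (projT2 a))).
Proof.
apply: smooth_to_vtot; first exact: aproj_smooth.
by move=> beta /smooth_dsectionP; exact.
Qed.

Lemma smooth_inclusion : smooth (@inclusion R M V A).
Proof. by apply: smooth_dsub; exact: smooth_aeval. Qed.

Lemma smooth_dilation (l : R) (l0 : l != 0) : smooth (@dilation R M V A l l0).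
Proof.
apply: smooth_dsub; apply: smooth_to_vtot; first exact: aproj_smooth.
move=> beta /(smooth_dsectionP affA) sb.
exact: (CinfM (@Cinf_cst R (atot A) l) sb).
Qed.

(** In a chart the coordinates of the retracted point are those of [z] divided
    by [eps z].  On the open set where the cutoff function does not vanish, they
    are quotients of functions smooth on the whole bundle. *)
Lemma retract_smooth : smooth retract.
Proof.
move=> f sf; apply/Cinf_atP => z.
have [N [r [Phi [phi [chi [cPhi schi chi1 chiN]]]]]] :=
  cut_chart_exists affA (bproj z).
pose W : set OffV := [set y | chi (bproj y) != 0].
have schiZ : Cinf (fun y : OffV => chi (bproj y)) by exact: bproj_smooth schi.
have oW : dopen W.
  move=> y; rewrite /W /= -normr_gt0 => y0.
  apply: dnbhsS (Cinf_continuous y schiZ y0) => t /=.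
  by apply: contraTneq => ->; rewrite sub0r normrN ltxx.
have Wz : W z by rewrite /W /= chi1 oner_neq0.
have NW (y : dsub W) : N (bproj (sval y)) := chi_out chiN (svalP y).
pose G (y : dsub W) : dprod (dsub N) (Rn R r) :=
  (exist _ (bproj (sval y)) (NW y),
   \row_i (ev (cut_coord cPhi chiN i) (sval (sval y)) *
     ((eps (sval (sval y)))^-1 * (chi (bproj (sval y)))^-1))).
have sWA : @smooth R (dsub W) (vtot At) (fun y => sval (sval y)).
  exact: (smooth_comp (@smooth_sval _ _ _) (@smooth_sval _ _ _)).
have sG : smooth G.
  apply: smooth_pair.
    apply: smooth_dsub; exact: (smooth_comp (@smooth_sval _ _ _) bproj_smooth).
  apply: smooth_Rn => i; under eq_fun do rewrite mxE.
  have s1 := sWA _ (Cinf_ev (smooth_cut_coord affA cPhi chiN schi i)).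
  have s2 := sWA _ (@Cinf_eps _ _ _ A).
  have s3 : Cinf (fun y : dsub W => chi (bproj (sval y))).
    exact: (@smooth_sval _ _ W _ schiZ).
  move/Cinf_atP in s1; move/Cinf_atP in s2; move/Cinf_atP in s3.
  apply/Cinf_atP => y; apply: Cinf_atM => //; apply: Cinf_atM; apply: Cinf_atV => //.
    exact: eps_neq0.
  exact: (svalP y).
apply: (@Cinf_at_dsub _ _ _ (f \o retract) (exist _ z Wz : dsub W) oW).
move: (exist _ z Wz : dsub W); apply/Cinf_atP.
have [_ _ _ [f' [_ sf' _ fK]]] := cPhi.
have := smooth_comp (smooth_comp sG sf') (@smooth_sval _ _ _) sf.
rewrite (_ : _ \o _ = fun y : dsub W => f (retract (sval y)))//.
apply/funext => y /=; congr f; have := fK (G y).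
case: (f' _) => -[m1 a1] h1 h /=.
have e1 : m1 = bproj (sval y) := congr1 (fun p => sval p.1) h.
have e2 : Phi m1 a1 = (G y).2 := congr1 snd h.
subst m1; congr existT.
have rE := retractE (sval y); rewrite /= in rE.
move: (sval (cid _)) rE => b rE.
rewrite -(pt_Phi affA cPhi a1 h1) -(pt_Phi affA cPhi b h1) e2; congr pt.
apply/rowP => i; rewrite mxE {1}/ev rE pairing_scaler pairing_aeval /=.
have c0 : chi (bproj (sval y)) != 0 := svalP y.
have e0y := eps_neq0 (sval y).
rewrite -!/(bproj (sval y)).
by field; rewrite c0.
Qed.

(** ** Vertical vectors *)

Lemma vline_diff (z : vtot At) (b : At (projT1 z)) g : @dgens R (vtot At) g ->
  differentiable (g \o (fun t : R =>
    existT _ (projT1 z) (projT2 z + t *: b) : vtot At)) (0 : R).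
Proof.
move=> [] [h sh ->].
  rewrite [X in differentiable X _](_ : _ = cst (h (projT1 z)))//.
rewrite [X in differentiable X _](_ : _ =
  (fun t : R => ev h z + t * pairing (h (projT1 z)) b))//.
Qed.

Lemma vline0 (z : vtot At) (b : At (projT1 z)) :
  existT _ (projT1 z) (projT2 z + 0 *: b) = z.
Proof. by case: z b => m z b /=; rewrite scale0r addr0. Qed.

Lemma derive_vline_ev (z : vtot At) (b : At (projT1 z)) beta :
  derive1 (fun t : R => ev beta
    (existT _ (projT1 z) (projT2 z + t *: b) : vtot At)) 0 =
  pairing (beta (projT1 z)) b.
Proof.
have -> : (fun t : R => ev beta
    (existT _ (projT1 z) (projT2 z + t *: b) : vtot At)) =
    (fun t : R => ev beta z + t * pairing (beta (projT1 z)) b).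
  by apply/funext => t.
rewrite derive1E.
have dt := is_deriveD (is_derive_cst (ev beta z) (0 : R) 1)
  (is_deriveM (is_derive_id (0 : R) 1)
     (is_derive_cst (pairing (beta (projT1 z)) b) (0 : R) 1)).
rewrite (@derive_val _ _ _ _ _ _ _ dt).
by rewrite scaler0 !add0r [_ *: _]mulr1.
Qed.

Lemma vliftE (z : vtot At) (b : At (projT1 z)) f : Cinf f ->
  vlift b f = derive1 (fun t : R => f
    (existT _ (projT1 z) (projT2 z + t *: b) : vtot At)) 0.
Proof.
move=> sf; apply: to_tangentE => // n phi h sphi sh.
have := curve_chain (vline_diff b) sphi sh.
by rewrite vline0.
Qed.

(** The line [z + t b] stays off [V] for small [t], as [eps] does not vanish at
    [z]; redefining it to be [z] at the other times gives a curve [c'] in the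
    subspace itself. *)
Lemma vlift_onE (z : OffV) (b : At (bproj z)) f : Cinf f ->
  vlift_on b (f \o sval) = derive1 (fun t : R => f
    (existT _ (bproj z) (projT2 (sval z) + t *: b) : vtot At)) 0.
Proof.
move=> sf.
pose c (t : R) : vtot At := existT _ (bproj z) (projT2 (sval z) + t *: b).
pose c' (t : R) : OffV := if pselect (offV (c t)) is left h then exist _ _ h else z.
have c'0 : c' 0 = z.
  rewrite /c'; case: pselect => // h; apply: dsub_eq; exact: vline0.
have near_c' : \forall t \near (0 : R), exists h : offV (c t), c' t = exist _ _ h.
  have := curve_diff (vline_diff b) (@Cinf_eps _ _ _ A).
  move=> /differentiable_continuous/cvgrPdist_lt/(_ `|eps (c 0)|).
  have e0 : 0 < `|eps (c 0)| by rewrite normr_gt0 /c vline0 eps_neq0.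
  move=> /(_ e0); apply: filterS => t /= ht.
  have oct : offV (c t).
    apply/offVP; apply: contraTneq ht => ct0.
    by rewrite -/(c t) -/(c 0) ct0 subr0 ltxx.
  exists oct; rewrite /c'; case: pselect => // h.
  by congr exist; exact: Prop_irrelevance.
have ext_c' h : \forall t \near (0 : R), extend0 h (c t) = h (c' t).
  apply: filterS near_c' => t [oct ->]; rewrite /extend0.
  by case: pselect => // h'; rewrite (Prop_irrelevance h' oct).
have sval_c' : \forall t \near (0 : R), c t = sval (c' t).
  by apply: filterS near_c' => t [oct ->].
have dc' g : @dgens R OffV g -> differentiable (g \o c') (0 : R).
  move=> [h sh ->]; have /derivable1_diffP dh := curve_diff (vline_diff b) sh.
  apply/derivable1_diffP; apply: near_eq_derivable dh.
  by apply: filterS sval_c' => t /= <-.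
have derive_c' h : derive1 (fun t : R => extend0 h (c t)) 0 = derive1 (h \o c') 0.
  by rewrite !derive1E; apply: near_eq_derive; exact: ext_c'.
rewrite -/(c _) /vlift_on to_tangentE; last by exact/smooth_sval.
  rewrite derive_c' !derive1E; apply: near_eq_derive.
  by apply: filterS sval_c' => t /= <-.
move=> n phi h sphi sh; rewrite derive_c' (curve_chain dc' sphi sh) c'0.
by apply: eq_bigr => i _; rewrite derive_c'.
Qed.

Lemma vlift_on_ev (z : OffV) (b : At (bproj z)) beta : smooth_dsection beta ->
  vlift_on b (ev beta \o sval) = pairing (beta (bproj z)) b.
Proof. by move=> sb; rewrite vlift_onE ?derive_vline_ev//; exact: Cinf_ev. Qed.

Lemma vlift_on_base (z : OffV) (b : At (bproj z)) f : Cinf f ->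
  vlift_on b (f \o @bproj R M At (@offV R M V A)) = 0.
Proof.
move=> sf; rewrite -[_ \o _]/((f \o @vproj R M At) \o sval) vlift_onE.
  exact: (derive1_cst (f (bproj z)) (0 : R)).
exact: smooth_vproj.
Qed.

End Linearized.

(** * Linearization *)
Section Linearization.
Variables (R : realType) (M : diffSpace R) (V : vbundle M) (A : abundle V).
Local Notation At := (Atilde A).
Local Notation OffV := (dsub (@offV R M V A)).
Local Notation proj := (@bproj R M At (@offV R M V A)).
Hypothesis affA : is_affine_bundle A.

Lemma Cinf_evZ beta : smooth_dsection beta ->
  @Cinf R OffV (fun y => ev beta (sval y)).
Proof. by move=> sb; exact: (@smooth_sval _ _ _ _ (Cinf_ev sb)). Qed.

(** The vector [b] is read off from the values of [w] on the coordinates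
    [eps, cut_coord i] of the fibre.  If [<beta, .>] is expanded in them, the
    coefficients are functions on [M], which [w] treats as constants; hence [w]
    and the vertical lift of [b] agree on all [<beta, .>].  Multiplication by
    [chi ^ 2] provides one factor for the frame and one for the coefficients. *)
Lemma vertical_vlift (z : OffV) (w : tangent z) :
  (forall f, Cinf f -> w (f \o proj) = 0) -> exists b, w = vlift_on b.
Proof.
move=> w0; pose m := proj z.
have [N [r [Phi [phi [chi [cPhi schi chi1 chiN]]]]]] := cut_chart_exists affA m.
pose b (al : adual A m) : R^o :=
  al (pt affA Phi m 0) * w (fun y => ev (e0 A) (sval y)) +
  \sum_(i < r) slope affA Phi al i * w (fun y => ev (cut_coord cPhi chiN i) (sval y)).
have lb : linear b.
  move=> c al be; pose w0' := w (fun y => ev (e0 A) (sval y)).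
  transitivity ((c * al (pt affA Phi m 0) + be (pt affA Phi m 0)) * w0' +
      \sum_(i < r) slope affA Phi (c *: al + be) i *
        w (fun y => ev (cut_coord cPhi chiN i) (sval y))); first by [].
  under eq_bigr do rewrite slopeP mulrDl -mulrA.
  rewrite big_split -mulr_sumr mulrDl -mulrA addrACA -mulrDr; exact: erefl.
have bP : b \in @linear_forms R (adual A m) by apply/asboolP.
exists (ABidual bP : At (proj z)); apply: tangent_eq_dsub => g [] [h sh ->].
  rewrite -[_ \o _]/(h \o proj) w0//; exact/esym/vlift_on_base.
rewrite -[_ \o _]/(ev h \o sval) vlift_on_ev// /pairing /= /b.
have wM (f : M -> R) (g' : OffV -> R) : Cinf f -> Cinf g' ->
    w (fun y => f (proj y) * g' y) = f m * w g'.
  move=> sf sg; rewrite der_mul ?(w0 f)// ?mulr0 ?addr0//.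
  exact: (bproj_smooth sf).
have sc : Cinf (fun y : OffV => chi (proj y)) by exact: (bproj_smooth schi).
have sb := smooth_cut_pt affA cPhi chiN schi 0 sh.
have sl i := smooth_cut_slope affA cPhi chiN schi i sh.
have se := Cinf_evZ (smooth_e0 A (fun m => m)).
have scc i := Cinf_evZ (smooth_cut_coord affA cPhi chiN schi i).
have : w (fun y => (chi (proj y) * chi (proj y)) * ev h (sval y)) =
  w (fun y => chi (proj y) * h (proj y) (pt affA Phi (proj y) 0) *
      (chi (proj y) * ev (e0 A) (sval y)) +
    \sum_(i < r) chi (proj y) * slope affA Phi (h (proj y)) i *
      ev (cut_coord cPhi chiN i) (sval y)).
  congr (tval w _); apply/funext => y.
  have yE : chi (proj y) * ev h (sval y) =
      chi (proj y) * h (proj y) (pt affA Phi (proj y) 0) * ev (e0 A) (sval y) +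
      \sum_(i < r) slope affA Phi (h (proj y)) i *
        ev (cut_coord cPhi chiN i) (sval y).
    exact: (cut_pairing affA cPhi chiN).
  rewrite -mulrA yE mulrDr mulr_sumr; congr (_ + _); first by rewrite mulrCA.
  by apply: eq_bigr => i _; rewrite mulrA.
rewrite (wM (fun m => chi m * chi m)) ?chi1 ?mul1r; last 2 first.
- exact: CinfM.
- exact: Cinf_evZ.
rewrite der_add; last 2 first.
- apply: CinfM; last exact: CinfM.
  exact: (bproj_smooth sb).
- apply: Cinf_sum => i; apply: CinfM => //; exact: (bproj_smooth (sl i)).
rewrite (wM _ (fun y => chi (proj y) * ev (e0 A) (sval y)) sb); last exact: CinfM.
rewrite (wM chi) // chi1 !mul1r => ->; congr (_ + _).
rewrite der_sum; last first.
  by move=> i; apply: CinfM => //; exact: (bproj_smooth (sl i)).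
by apply: eq_bigr => i _; rewrite (wM _ _ (sl i))// chi1 mul1r.
Qed.

Variables (xi : hlift (@aproj R M V A)) (xit : hlift proj).
Hypothesis hxi : is_homogeneous_extension xi xit.

(** By homogeneity [xit v] is the image under a dilation [z |-> l z] of a vector
    tangent to [A], and [eps] is the constant [l] on the image of [A]. *)
Lemma horizontal_eps (z : OffV) (v : tangent (proj z)) :
  xit v (@eps R M V A \o sval) = 0.
Proof.
have [l [l0 [a zE]]] : exists l (l0 : l != 0) a, @dilation R M V A l l0 a = z.
  exists (eps (sval z)), (eps_neq0 affA z), (retract affA z).
  exact: dilation_retract.
move: v; rewrite -zE => v; rewrite (hxi.2 l l0 a v).
rewrite tangent_mapE; last 2 first.
- exact: smooth_dilation.
- exact: (@smooth_sval _ _ _ _ (Cinf_eps A)).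
rewrite (_ : _ \o _ = fun=> l) ?der_cst//.
by apply/funext => b; rewrite /= /eps /ev pairing_scaler pairing_aeval /= mulr1.
Qed.

(** [u] is the sum of the horizontal lift of its projection and of a vertical
    lift of some [b]; then [kappa u = b] and [<e0, b> = u eps].  If no linear
    left inverse of the vertical lift annihilates the horizontal lift, [kappa]
    is [0]. *)
Lemma kappa_eps (z : OffV) (u : tangent z) :
  u (@eps R M V A \o sval) = 0 -> pairing (e0 A (proj z)) (kappa xit u) = 0.
Proof.
move=> u0; rewrite /kappa; case: xgetP => [k _ [lk kv kh]|_]; last by [].
have [_ xiP _] := hxi.1.
have [b bE] : exists b, u - xit (tangent_map proj u) = vlift_on b.
  apply: vertical_vlift => f sf.
  have := congr1 (fun v => tval v f) (xiP z (tangent_map proj u)).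
  rewrite !tangent_mapE//; try exact: bproj_smooth.
  by move=> h; rewrite -[LHS]/(u _ - xit _ _) h subrr.
have -> : k u = b.
  have := lk 1 (xit (tangent_map proj u)) (vlift_on b).
  by rewrite kh kv scaler0 add0r scale1r -bE [_ + (u - _)]addrC subrK.
rewrite -(vlift_on_ev affA b (smooth_e0 A _)) -bE.
by rewrite -[LHS]/(u _ - xit _ _) horizontal_eps u0 subrr.
Qed.

Lemma Cinf_epsZ : @Cinf R OffV (@eps R M V A \o sval).
Proof. exact: (@smooth_sval _ _ _ _ (Cinf_eps A)). Qed.

(** [e0] vanishes on both terms because the vertical and the horizontal part of
    [U] annihilate [eps], and [eps] is equal to [1] on [s].  Where a
    bracket is not a derivation or a vector not vertical, the corresponding term
    is [0]. *)
Lemma linearization_eps (U : vfield OffV) (s : section At proj) (z : OffV) :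
  smooth_section s -> (forall y, pairing (e0 A (proj y)) (s y) = 1) ->
  (forall y, U y (@eps R M V A \o sval) = 0) ->
  pairing (e0 A (proj z)) (linearization xit U s z) = 0.
Proof.
move=> ss s1 U0.
have PV0 y : PV xit (U y) (@eps R M V A \o sval) = 0.
  by rewrite /PV vlift_on_ev ?kappa_eps//; exact: smooth_e0.
rewrite /linearization pairing_addr.
rewrite [X in X + _]kappa_eps ?add0r; last first.
  have [->|//] := lie_bracket_or (fun y => PH xit (U y))
    (fun y => vlift_on (s y)) z Cinf_epsZ.
  rewrite [X in PH xit (U z) X](_ : _ = fun=> 1); last first.
    by apply/funext => y; rewrite vlift_on_ev ?s1//; exact: smooth_e0.
  rewrite [X in vlift_on (s z) X](_ : _ = fun=> 0) ?der_cst ?subrr//.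
  apply/funext => y; rewrite -[LHS]/(U y _ - PV xit (U y) _).
  by rewrite U0 PV0 subrr.
rewrite /vlift_inv; case: xgetP => [b _ bE|_]; last by [].
transitivity (vlift b (@eps R M V A)).
  rewrite vliftE; first by rewrite derive_vline_ev.
  exact: Cinf_eps.
rewrite bE tangent_mapE//; last exact: Cinf_eps.
rewrite (_ : _ \o _ = fun=> 1) ?der_cst//.
by apply/funext => y; exact: s1.
Qed.

(** A dilation carries [U] from [A] to every other level set of [eps], so the
    extended field annihilates [eps]. *)
Definition extend_vfield (U : vfield (atot A)) : vfield OffV := fun z =>
  to_tangent z (fun f => U (retract affA z) (f \o dilation (eps_neq0 affA z))).

Lemma extend_vfieldE U z f : Cinf f -> extend_vfield U z f =
  U (retract affA z) (f \o dilation (eps_neq0 affA z)).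
Proof.
apply: to_tangentE => n phi g sphi sg.
have sd := smooth_dilation affA (eps_neq0 affA z).
have rowE : eval_row (fun i => g i \o dilation (eps_neq0 affA z)) (retract affA z)
    = eval_row g z.
  by apply/rowP => i; rewrite !mxE /= dilation_retract.
by have := der_chain (U (retract affA z)) sphi (fun i => sd _ (sg i)); rewrite rowE.
Qed.

Lemma extend_vfield_eps U z : extend_vfield U z (@eps R M V A \o sval) = 0.
Proof.
rewrite extend_vfieldE; last exact: Cinf_epsZ.
rewrite (_ : _ \o _ = fun=> eps (sval z)) ?der_cst//.
by apply/funext => b; rewrite /= /eps /ev pairing_scaler pairing_aeval /= mulr1.
Qed.

Lemma smooth_extend_vfield U : smooth_vfield U -> smooth_vfield (extend_vfield U).
Proof.
move=> sU; apply: smooth_vfield_dsub => g [] [h sh ->].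
  rewrite (_ : (fun x => _) = (fun a => U a (h \o @aproj R M V A)) \o retract affA).
    apply: (retract_smooth affA); apply: smooth_vfield_Cinf => //.
    exact: (aproj_smooth affA sh).
  apply/funext => z; rewrite extend_vfieldE//; exact: (bproj_smooth sh).
have sh' := (smooth_dsectionP affA _).1 sh.
rewrite (_ : (fun x => _) = fun z : OffV => eps (sval z) *
    U (retract affA z) (fun a : atot A => h (projT1 a) (projT2 a))).
  apply: CinfM; first exact: Cinf_epsZ.
  by have := retract_smooth affA (smooth_vfield_Cinf sU sh').
apply/funext => z; rewrite extend_vfieldE; last exact: (Cinf_evZ sh).
by rewrite -der_scale.
Qed.

Lemma extend_vfield_inclusion U a :
  extend_vfield U (inclusion a) = tangent_map (@inclusion R M V A) (U a).
Proof.
apply: tangent_eq => f sf; rewrite extend_vfieldE// tangent_mapE//; last first.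
  exact: smooth_inclusion.
rewrite retract_inclusion; congr (tval (U a) _); apply/funext => b /=.
congr f; apply: dsub_eq => /=; congr existT.
by rewrite [eps _]/(1 : R) scale1r.
Qed.

End Linearization.

(** * Sections of [A] and parallelism *)
Section Parallel.
Variables (R : realType) (M : diffSpace R) (V : vbundle M) (A : abundle V).
Local Notation At := (Atilde A).
Hypothesis affA : is_affine_bundle A.

(** The linearization is evaluated on the extensions of [U] and [s] along the
    retraction. *)
Lemma secA_eps (xi : hlift (@aproj R M V A)) (D : cov_op At (@aproj R M V A)) U s :
  is_affine_linearization xi D -> smooth_vfield U -> secA s ->
  forall a, pairing (e0 A (aproj a)) (D U s a) = 0.
Proof.
move=> [xit [hxi [_ DE]]] sU [ss sA] a.
pose s0 : section At (@bproj R M At (@offV R M V A)) := fun z => s (retract affA z).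
have ss0 : smooth_section s0 := smooth_comp (retract_smooth affA) ss.
have s0E : (fun y => s0 (inclusion y)) = s.
  apply: functional_extensionality_dep => -[m b]; rewrite /s0.
  have e : sval (cid (retract_subproof affA (inclusion (existT _ m b)))) = b.
    exact: (existT_inj (retract_inclusion affA (existT _ m b))).
  by rewrite /retract e.
have := DE U (extend_vfield affA U) s0 sU (smooth_extend_vfield affA sU) ss0
  (extend_vfield_inclusion affA U) a.
rewrite s0E => ->.
refine (@linearization_eps _ _ _ _ affA xi xit hxi (extend_vfield affA U) s0
  (inclusion a) ss0 _ _) => z.
  exact: (inA_pairing1 (sA (retract affA z))).
exact: extend_vfield_eps.
Qed.

Lemma secA_taut : secA (fun a : atot A => aeval (projT2 a) : At (aproj a)).
Proof. by split=> [|a]; [exact: smooth_aeval|exists (projT2 a)]. Qed.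

Lemma smooth_section_dsection (s : section At (@aproj R M V A)) :
  (forall beta : dsection A (fun m : M => m), smooth_dsection beta ->
     Cinf (fun a : atot A => pairing (beta (aproj a)) (s a))) ->
  smooth_section s.
Proof. by move=> ss; apply: smooth_to_vtot => //; exact: aproj_smooth. Qed.

Lemma Cinf_pairing (s : section At (@aproj R M V A))
    (beta : dsection A (fun m : M => m)) :
  smooth_section s -> smooth_dsection beta ->
  Cinf (fun a : atot A => pairing (beta (aproj a)) (s a)).
Proof. by move=> ss sb; exact: (ss _ (Cinf_ev sb)). Qed.

(** In the chart, add to the tautological section a constant vector multiplied
    by the cutoff function. *)
Lemma secA_through (a : atot A) (b : A (aproj a)) : exists s, secA s /\ s a = aeval b.
Proof.
pose m := aproj a.
have [N [r [Phi [phi [chi [cPhi schi chi1 chiN]]]]]] := cut_chart_exists affA m.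
pose x := Phi _ b - Phi _ (projT2 a).
pose s (c : atot A) : At (aproj c) := aeval (projT2 c) +
  chi (aproj c) *: \sum_(i < r) x 0 i *:
    (aeval (pt affA Phi (aproj c) (delta_mx 0 i)) - aeval (pt affA Phi (aproj c) 0)).
have sE (c : atot A) (al : adual A (aproj c)) : pairing al (s c) =
    al (projT2 c) + \sum_(i < r) x 0 i * (chi (aproj c) * slope affA Phi al i).
  rewrite /s pairing_addr pairing_scaler pairing_sumr mulr_sumr pairing_aeval.
  by congr (_ + _); apply: eq_bigr => i _; rewrite pairing_scaler mulrCA.
exists s; split; first split.
- apply: smooth_section_dsection => beta sb; under eq_fun do rewrite sE.
  apply: CinfD; first exact/(smooth_dsectionP affA).
  apply: Cinf_sum => i; apply: CinfM; first exact: Cinf_cst.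
  exact: (aproj_smooth affA (smooth_cut_slope affA cPhi chiN schi i sb)).
- move=> c; apply: pairing1_inA => //; rewrite sE big1 ?addr0// => i _.
  by rewrite /slope subrr !mulr0.
- have Nm : N m by apply: (chi_out chiN); rewrite chi1 oner_neq0.
  apply: At_eq => al; rewrite sE chi1 pairing_aeval.
  rewrite (adual_chart affA cPhi al b Nm) (adual_chart affA cPhi al (projT2 a) Nm).
  rewrite -addrA -big_split; congr (_ + _); apply: eq_bigr => i _ /=.
  by rewrite !mxE; ring.
Qed.

End Parallel.

Theorem proposition4p6 (R : realType) (n : nat) (M : diffSpace R)
    (V : vbundle M) (A : abundle V) (xi : hlift (@aproj R M V A))
    (D : cov_op (Atilde A) (@aproj R M V A))
    (Dd : vfield (atot A) -> dsection A (@aproj R M V A) ->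
          dsection A (@aproj R M V A)) :
  is_manifold n M ->
  is_vector_bundle V ->
  is_affine_bundle A ->
  is_connection xi ->
  is_affine_linearization xi D ->
  is_dual_derivative D Dd ->
  [/\ forall U, smooth_vfield U ->
        Dd U (fun a => e0 A (aproj a)) = (fun a => 0),
      forall U s, smooth_vfield U -> secV s -> secV (D U s) &
      forall U s, smooth_vfield U -> secA s -> secV (D U s)].
Proof.
move=> _ _ affA _ linD dualD.
have Deps := secA_eps affA linD.
have [_ [_ [[Dsmooth _ Dadd _] _]]] := linD.
split=> [U sU|U s sU [ss sV]|U s sU sA].
- apply: functional_extensionality_dep => a; apply: adual_eq => b.
  have [s [sA sb]] := secA_through affA b.
  have [_ /(_ s sA.1 a)] := dualD U _ sU (smooth_e0 A (@aproj R M V A)).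
  rewrite Deps// subr0 sb pairing_aeval => ->.
  rewrite (_ : (fun c => _) = fun=> 1) ?der_cst//.
  by apply/funext => c; exact: inA_pairing1 (sA.2 c).
- have [st tA] := secA_taut affA.
  pose t (a : atot A) : Atilde A (aproj a) := aeval (projT2 a).
  split; first exact: Dsmooth.
  have sts : secA (fun a => t a + s a).
    split=> [|a].
      apply: smooth_section_dsection => // beta sb.
      exact: (CinfD (Cinf_pairing st sb) (Cinf_pairing ss sb)).
    apply: pairing1_inA => //.
    by rewrite pairing_addr (inV_pairing0 (sV a)) (inA_pairing1 (tA a)) addr0.
  move=> a; apply: pairing0_inV => //.
  have := Deps U _ sU sts a; rewrite Dadd// pairing_addr.
  by rewrite Deps// add0r.
- split; first by apply: Dsmooth => //; exact: sA.1.
  by move=> a; apply: pairing0_inV => //; exact: Deps.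
Qed.
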